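(* Consider $(S^3,g_\mu)$ with $\mu>0$. If $\mu>2$ and $\lambda>\dfrac{(\mu-3)^2}{\mu-2}$, then the Hopf vector field $V^\mu$ is unstable as a critical point of the generalized energy $E_{g_\lambda}$.
   Context: $S^{3}\subset\mathbb{R}^{4}\cong\mathbb{C}^{2}$ is the unit sphere, $g$ its usual metric, $N$ the outward unit normal ($N(p)=p$), $J$ the usual complex structure of $\mathbb{R}^4$, and $V=JN$ (so $V(p)=ip$). For $\mu>0$ the Riemannian Berger metric $g_\mu$ on $S^3$ is defined by $g_\mu|_{V^\perp}=g|_{V^\perp}$, $g_\mu(V,V)=\mu\, g(V,V)$, $g_\mu(V,V^\perp)=0$. The Hopf vector field is the $g_\mu$-unit field $V^\mu=\frac{1}{\sqrt{\mu}}V$. Let $\nabla^\mu$ be the Levi-Civita connection of $g_\mu$. For $\lambda>0$ the generalized energy of a $g_\mu$-unit smooth vector field $X$ on $(S^3,g_\mu)$ is $E_{g_\lambda}(X)=\frac12\int_{S^3}\operatorname{tr}(L_{(g_\lambda,X)})\,\mathrm{dv}_{g_\lambda}$, where the endomorphism $L_{(g_\lambda,X)}$ is determined by $g_\lambda(L_{(g_\lambda,X)}Y,Z)=g_\mu(Y,Z)+g_\mu(\nabla^\mu_YX,\nabla^\mu_ZX)$ (the right-hand side is the pull-back by $X$ of the Sasaki metric of $g_\mu$) and $\mathrm{dv}_{g_\lambda}$ is the volume measure of $g_\lambda$ (the Berger metric with parameter $\lambda$). $E_{g_\lambda}$ is restricted to the set of $g_\mu$-unit vector fields, and $V^\mu$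 is a critical point of this restriction. The Hessian of $E_{g_\lambda}$ at the critical point $V^\mu$, acting on a smooth vector field $A$ that is $g_\mu$-orthogonal to $V^\mu$, is $\frac{d^2}{dt^2}\big|_{t=0}E_{g_\lambda}(X_t)$ for any smooth variation $X_t$ by unit vector fields with $X_0=V^\mu$, $\frac{d}{dt}|_{t=0}X_t=A$. The critical point is stable if the Hessian is positive semi-definite, and unstable otherwise, i.e. if the Hessian is negative on some $A$. *)

(* Defs.v *)
From HB Require Import structures.
From mathcomp Require Import all_boot all_order all_algebra.
From mathcomp Require Import all_classical all_reals all_analysis.

Set Implicit Arguments.
Unset Strict Implicit.
Unset Printing Implicit Defensive.

Import Order.TTheory GRing.Theory Num.Theory.
Import numFieldNormedType.Exports.

Local Open Scope classical_set_scope.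
Local Open Scope ring_scope.

(* Tensors and vector fields on S^3 are represented by maps on the ambient R^4
   whose values off S^3 are irrelevant. *)

Section Smooth.
Variables (R : realType) (V W : normedModType R).

Definition iter_derive (s : seq V) (f : V -> W) : V -> W :=
  foldr (fun v (g : V -> W) x => 'D_v g x) f s.

(* For finite-dimensional V this is C^oo on the open set U: all iterated
   directional derivatives exist and are continuous on U. *)
Definition smooth_on (U : set V) (f : V -> W) : Prop :=
  open U /\
  forall (s : seq V) (x : V), U x ->
    {for x, continuous (iter_derive s f)} /\
    forall v, derivable (iter_derive s f) x v.

(* Smoothness of the restriction of f to a closed set S, f being itself the
   smooth local extension. *)
Definition smooth_near (S : set V) (f : V -> W) : Prop :=
  exists2 U : set V, S `<=` U & smooth_on U f.

End Smooth.

Section Berger.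
Variable R : realType.
Local Notation E := 'rV[R]_4.

Definition dot (u v : E) : R := \sum_i u 0 i * v 0 i.

Definition S3 : set E := [set p | dot p p = 1].

Definition vec4 (a b c d : R) : E := \row_(j < 4) [:: a; b; c; d]`_j.

(* R^4 = C^2 by (x0 + i x1, x2 + i x3); equivalently x is the quaternion
   x0 + x1 i + x2 j + x3 k, and imul, jmul, kmul are the left multiplications
   by i, j, k.  In particular imul is J, and V = JN is imul restricted to S^3. *)
Definition imul (p : E) : E := vec4 (- p 0 1) (p 0 0) (- p 0 3) (p 0 2).
Definition jmul (p : E) : E := vec4 (- p 0 2) (p 0 3) (p 0 0) (- p 0 1).
Definition kmul (p : E) : E := vec4 (- p 0 3) (- p 0 2) (p 0 1) (p 0 0).

(* At each point of S^3 a basis of the tangent space (for g, orthonormal). *)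
Definition frame (i : 'I_3) : E -> E :=
  nth imul [:: imul; jmul; kmul] i.

(* Component in V^perp of a vector tangent to S^3 at p. *)
Definition hor (p Y : E) : E := Y - dot Y (imul p) *: imul p.

(* The Berger metric at p: equal to g on V^perp, with V orthogonal to V^perp
   and of square length mu. *)
Definition berger (mu : R) (p Y Z : E) : R :=
  dot (hor p Y) (hor p Z) + mu * (dot Y (imul p) * dot Z (imul p)).

Definition tangent (X : E -> E) : Prop :=
  forall p, S3 p -> dot (X p) p = 0.

Definition vector_field (X : E -> E) : Prop := smooth_near S3 X /\ tangent X.

Definition unit_field (mu : R) (X : E -> E) : Prop :=
  vector_field X /\ forall p, S3 p -> berger mu p (X p) (X p) = 1.

Definition hopf_field (mu : R) (p : E) : E := (Num.sqrt mu)^-1 *: imul p.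

(* [nabla Y X] stands for nabla_Y X.  On S^3, the derivative in a tangent
   direction does not depend on the extension, and D_X Y - D_Y X is the Lie
   bracket [X, Y]. *)
Record levi_civita (mu : R) (nabla : (E -> E) -> (E -> E) -> E -> E) : Prop :=
  LeviCivita {
  lc_field : forall X Y, vector_field X -> vector_field Y ->
    vector_field (nabla Y X);
  lc_addl : forall X Y Z, vector_field X -> vector_field Y -> vector_field Z ->
    forall p, S3 p ->
    nabla (fun q => Y q + Z q) X p = nabla Y X p + nabla Z X p;
  lc_addr : forall X Y Z, vector_field X -> vector_field Y -> vector_field Z ->
    forall p, S3 p ->
    nabla Y (fun q => X q + Z q) p = nabla Y X p + nabla Y Z p;
  lc_scalel : forall (f : E -> R) X Y,
    smooth_near S3 (f : E -> R^o) -> vector_field X -> vector_field Y ->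
    forall p, S3 p ->
    nabla (fun q => f q *: Y q) X p = f p *: nabla Y X p;
  lc_leibniz : forall (f : E -> R) X Y,
    smooth_near S3 (f : E -> R^o) -> vector_field X -> vector_field Y ->
    forall p, S3 p ->
    nabla Y (fun q => f q *: X q) p =
      'D_(Y p) (f : E -> R^o) p *: X p + f p *: nabla Y X p;
  lc_torsion_free : forall X Y, vector_field X -> vector_field Y ->
    forall p, S3 p ->
    nabla X Y p - nabla Y X p = 'D_(X p) Y p - 'D_(Y p) X p;
  lc_metric : forall X Y Z, vector_field X -> vector_field Y ->
    vector_field Z -> forall p, S3 p ->
    'D_(Z p) (fun q => berger mu q (X q) (Y q) : R^o) p =
      berger mu p (nabla Z X p) (Y p) + berger mu p (X p) (nabla Z Y p)
  }.

(* Hopf coordinates: a chart of S^3 onto the complement of a null set. *)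
Definition hopf_chart (u : R * R * R) : E :=
  let: (eta, xi1, xi2) := u in
  vec4 (cos eta * cos xi1) (cos eta * sin xi1)
       (sin eta * cos xi2) (sin eta * sin xi2).

Definition hopf_chart_dom : set (R * R * R) :=
  (`]0, pi / 2[ `*` `]0, 2 * pi[) `*` `]0, 2 * pi[.

Definition coord_dir (i : 'I_3) : R^o * R^o * R^o :=
  ((i == 0)%:R, (i == 1)%:R, (i == 2)%:R).

Definition coord_field (i : 'I_3) (u : R * R * R) : E :=
  'D_(coord_dir i) (hopf_chart : R^o * R^o * R^o -> E) u.

Definition volume_density (lambda : R) (u : R * R * R) : R :=
  Num.sqrt (\det (\matrix_(i < 3, j < 3)
    berger lambda (hopf_chart u) (coord_field i u) (coord_field j u))).

Definition integral_S3 (lambda : R) (f : E -> R) : R :=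
  (\int[(@lebesgue_measure R \x @lebesgue_measure R \x @lebesgue_measure R)%E]_(u in
     hopf_chart_dom) (f (hopf_chart u) * volume_density lambda u)).

Section Energy.
Variables (mu lambda : R) (nabla : (E -> E) -> (E -> E) -> E -> E).

Definition gram (p : E) : 'M[R]_3 :=
  \matrix_(i, j) berger lambda p (frame i p) (frame j p).

Definition pullback_sasaki (X Y Z : E -> E) (p : E) : R :=
  berger mu p (Y p) (Z p) + berger mu p (nabla Y X p) (nabla Z X p).

(* Matrix of the endomorphism L of T_p S^3 in the frame: the equation
   g_lambda(L Y, Z) = pullback_sasaki X Y Z reads  L^T *m G = B,  and G and B
   are symmetric. *)
Definition L_matrix (X : E -> E) (p : E) : 'M[R]_3 :=
  invmx (gram p) *m \matrix_(i, j) pullback_sasaki X (frame i) (frame j) p.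

Definition energy (X : E -> E) : R :=
  2^-1 * integral_S3 lambda (fun p => \tr (L_matrix X p)).

(* Smooth variations of X0 through g_mu-unit fields, with velocity A at t = 0;
   X t only matters for t near 0. *)
Definition unit_variation (X0 : E -> E) (X : R -> E -> E) (A : E -> E) : Prop :=
  exists e : R,
    [/\ 0 < e,
        exists2 W : set (R^o * E),
          (forall t p, `|t| < e -> S3 p -> W (t, p)) &
          smooth_on W (fun tp : R^o * E => X tp.1 tp.2),
        forall t, `|t| < e -> unit_field mu (X t),
        forall p, S3 p -> X 0 p = X0 p &
        forall p, S3 p -> 'D_1 (fun t : R^o => X t p) 0 = A p].

Definition critical (X0 : E -> E) : Prop :=
  forall X A, unit_variation X0 X A ->
    is_derive (0 : R^o) 1 (fun t : R^o => energy (X t) : R^o) 0.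

Definition has_second_derivative0 (f : R^o -> R^o) (h : R) : Prop :=
  (\forall t \near (0 : R^o), derivable f t 1) /\
  is_derive (0 : R^o) 1 (f^`())%classic h.

(* h is the value at A of the Hessian of the energy at X0. *)
Definition hessian (X0 A : E -> E) (h : R) : Prop :=
  (exists X, unit_variation X0 X A) /\
  forall X, unit_variation X0 X A ->
    has_second_derivative0 (fun t : R^o => energy (X t)) h.

Definition hessian_field (X0 A : E -> E) : Prop :=
  vector_field A /\ forall p, S3 p -> berger mu p (A p) (X0 p) = 0.

Definition unstable_critical_point (X0 : E -> E) : Prop :=
  critical X0 /\
  exists A h, [/\ hessian_field X0 A, hessian X0 A h & h < 0].

End Energy.
End Berger.

(* Main.v *)
(* On S^3 the frame i p, j p, k p is orthogonal for every Berger metric, and by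
   Koszul's formula tr L is a quadratic polynomial in the components of X in this
   frame and their derivatives along it.  The fields j p and k p preserve the
   volume, so a derivative along them integrates to 0; with g_mu(X, X) = 1 this
   turns the integral of tr L into that of a constant plus a combination of
   squares of functions that vanish when X = V^mu.  So V^mu is critical, and its
   Hessian at A is the integral of the same combination of squares of the
   corresponding functions of A.  Take A = - x2 j p + x3 k p.  As x0^2 + x1^2 and
   x2^2 + x3^2 have the same integral over S^3, the Hessian is a positive multiple
   of (mu - 3)^2 / lambda - mu + 2, which is negative. *)

Require Import Defs.
From HB Require Import structures.
From mathcomp Require Import all_boot all_order all_algebra.
From mathcomp Require Import all_classical all_reals all_analysis.
From mathcomp Require Import measurable_realfun ring lra.

Set Implicit Arguments.
Unset Strict Implicit.
Unset Printing Implicit Defensive.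

Import Order.TTheory GRing.Theory Num.Theory.
Import numFieldNormedType.Exports.
Local Open Scope classical_set_scope.
Local Open Scope ring_scope.

(** * Smooth functions *)

(** The Hessian must take the same value for every variation with velocity A, whereas a second
    derivative along X_t in general involves the acceleration of X_t. In the square of a function
    that vanishes at t = 0 the acceleration drops out; this is why tr L is brought to that form. The
    linear terms in the way go for two reasons: those in derivatives along j p and k p integrate to
    0, and the one in the component along V is absorbed by 2 mu times the condition g_mu(X, X) = 1,
    where 2 mu acts as the Lagrange multiplier of the constraint. Smoothness is given through
    iterated directional derivatives alone, so linearity in the direction, the chain rule along
    curves and the symmetry of second derivatives have to be derived from it. Unit length, initial
    field and velocity of a variation are prescribed on S^3 only, so derivatives are compared in
    directions tangent to S^3. In Hopf coordinates the divergence theorem becomes the fundamental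
    theorem of calculus in each of three variables. *)

Section SmoothTheory.
Context {R : realType} {V W : normedModType R}.
Implicit Types (U : set V) (f g : V -> W).

(** A coinduction principle with [C] as invariant. By induction on the list of directions, each
    iterated derivative agrees on [U] with a member of [C]; since [U] is open, agreement on [U]
    passes to the next derivative. *)
Lemma smooth_on_coind U (C : (V -> W) -> Prop) :
  open U ->
  (forall f x, C f -> U x -> {for x, continuous f}) ->
  (forall f v, C f -> exists2 g, C g & forall x, U x -> is_derive x v f (g x)) ->
  forall f, C f -> smooth_on U f.
Proof.
move=> oU Cc Cd f Cf; split=> // s.
have nearU x : U x -> \forall y \near x, U y.
  by move=> Ux; apply: open_nbhs_nbhs.
have [g Cg fg] : exists2 g, C g & forall x, U x -> iter_derive s f x = g x.
  elim: s => [|v s [g Cg fg]]; first by exists f.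
  have [h Ch gh] := Cd g v Cg; exists h => // x Ux /=.
  rewrite (@near_eq_derive _ _ _ _ g); last first.
    by near=> y; apply: fg; near: y; exact: nearU.
  by have [] := gh x Ux.
move=> x Ux; have fgx : {near x, g =1 iter_derive s f}.
  by near=> y; apply/esym/fg; near: y; exact: nearU.
split.
  rewrite /prop_for /continuous_at fg //.
  by apply: cvg_trans (Cc _ _ Cg Ux); apply: near_eq_cvg.
move=> v; have [h _ gh] := Cd g v Cg.
by apply: (near_eq_derivable fgx); have [] := gh x Ux.
Unshelve. all: by end_near. Qed.

Lemma smooth_on_open U f : smooth_on U f -> open U.
Proof. by case. Qed.

Lemma smooth_on_continuous U f x : smooth_on U f -> U x -> {for x, continuous f}.
Proof. by case=> _ /(_ [::] x) h /h[]. Qed.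

Lemma smooth_on_derivable U f x v : smooth_on U f -> U x -> derivable f x v.
Proof. by case=> _ /(_ [::] x) h /h[]. Qed.

Lemma smooth_on_derive U f v : smooth_on U f -> smooth_on U (fun x => 'D_v f x).
Proof.
case=> oU sf; split=> // s x Ux.
have -> : iter_derive s (fun x => 'D_v f x) = iter_derive (rcons s v) f.
  by rewrite /iter_derive foldr_rcons.
exact: sf.
Qed.

Lemma smooth_on_is_derive U f x v :
  smooth_on U f -> U x -> is_derive x v f ('D_v f x).
Proof. by move=> sf Ux; apply/derivableP; apply: smooth_on_derivable sf Ux. Qed.

Lemma smooth_onW U U' f : open U' -> U' `<=` U -> smooth_on U f -> smooth_on U' f.
Proof. by move=> oU' sub [_ sf]; split=> // s x /sub; apply: sf. Qed.

Lemma smooth_on_near_derive U f g x v : open U -> U x ->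
  (forall y, U y -> f y = g y) -> 'D_v f x = 'D_v g x.
Proof.
move=> oU Ux fg; apply: near_eq_derive.
by near=> y; apply: fg; near: y; apply: open_nbhs_nbhs.
Unshelve. all: by end_near. Qed.

Lemma smooth_on_cst U (c : W) : open U -> smooth_on U (fun=> c).
Proof.
move=> oU; apply: (@smooth_on_coind _ (fun f => exists c : W, f = cst c)) => //.
- by move=> _ x [d ->] _; apply: cst_continuous.
- by move=> _ v [d ->]; exists (cst 0) => // *; [exists 0| apply: is_derive_cst].
- by exists c.
Qed.

Lemma smooth_on_linear U (l : {linear V -> W}) :
  open U -> continuous l -> smooth_on U l.
Proof.
move=> oU lc.
apply: (@smooth_on_coind _ (fun f => f = l \/ exists c : W, f = cst c)) => //.
- move=> _ x [->|[d ->]] _; [exact: lc|exact: cst_continuous].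
- move=> _ v [->|[d ->]].
    exists (cst (l v)); first by right; exists (l v).
    move=> x _; have dl : differentiable l x by apply: linear_differentiable.
    apply: DeriveDef; first exact: diff_derivable.
    by rewrite deriveE // diff_lin.
  exists (cst 0) => [|x _]; [by right; exists 0|exact: is_derive_cst].
- by left.
Qed.

(** Both difference quotients are the same function of the increment. This carries one-variable
    results, such as the chain rule and the mean value theorem, over to directional derivatives. *)
Lemma is_derive_line f x v (df : W) (s : R) :
  is_derive (s *: v + x) v f df <->
  is_derive s 1 (fun t : R => f (t *: v + x)) df.
Proof.
have E : (fun t : R => t^-1 *: ((f \o shift (s *: v + x)) (t *: v) - f (s *: v + x))) =
    (fun t : R => t^-1 *: (((fun h : R => f (h *: v + x)) \o shift s) (t *: 1) -
        f (s *: v + x))).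
  by apply/funext => t /=; rewrite [t *: 1]mulr1 scalerDl addrA.
split=> [] [k1 k2]; apply: DeriveDef.
- by move: k1; rewrite /derivable E.
- by rewrite -k2 /derive E.
- by move: k1; rewrite /derivable E.
- by rewrite -k2 /derive E.
Qed.

End SmoothTheory.
Arguments smooth_on_derive {R V W U f} v.
Arguments smooth_on_derivable {R V W U f x} v.

Section SmoothAlgebra.
Context {R : realType} {V : normedModType R}.
Implicit Types (U : set V) (f g : V -> R^o).

(** The invariant for [smooth_on_coind]. Products alone are not stable under derivation, nor are
    compositions with sin and cos; the whole algebra generated from smooth functions is. *)
Inductive smooth_alg U : (V -> R^o) -> Prop :=
| SmoothAlgBase f of smooth_on U f : smooth_alg U f
| SmoothAlgD f g of smooth_alg U f & smooth_alg U g :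
    smooth_alg U (fun x => f x + g x)
| SmoothAlgM f g of smooth_alg U f & smooth_alg U g :
    smooth_alg U (fun x => f x * g x)
| SmoothAlgSin f of smooth_alg U f : smooth_alg U (fun x => sin (f x))
| SmoothAlgCos f of smooth_alg U f : smooth_alg U (fun x => cos (f x)).

Lemma is_derive_chain (h : R -> R) f (dh df : R) x v :
  is_derive (f x) 1 h dh -> is_derive x v f df ->
  is_derive x v (fun y => h (f y) : R^o) (dh * df).
Proof.
move=> hd fd; have -> : x = 0 *: v + x by rewrite scale0r add0r.
apply: (is_derive_line (fun y => h (f y) : R^o) x v (dh * df) 0).2.
apply: (@is_derive1_comp _ h (fun t : R => f (t *: v + x))).
  by rewrite scale0r add0r.
by apply: (is_derive_line f x v df 0).1; rewrite scale0r add0r.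
Qed.

Lemma smooth_algP U f : open U -> smooth_alg U f -> smooth_on U f.
Proof.
move=> oU; apply: smooth_on_coind => // {}f.
- move=> x; elim=> {f} [f|f g _ Cf _ Cg|f g _ Cf _ Cg|f _ Cf|f _ Cf] => Ux.
  + exact: smooth_on_continuous.
  + by apply: cvgD; [exact: Cf|exact: Cg].
  + by apply: cvgM; [exact: Cf|exact: Cg].
  + by apply: continuous_comp; [exact: Cf|exact: continuous_sin].
  + by apply: continuous_comp; [exact: Cf|exact: continuous_cos].
- move=> v; elim=> {f} [f sf|f g Cf [f' Cf' ff'] Cg [g' Cg' gg']
    |f g Cf [f' Cf' ff'] Cg [g' Cg' gg']|f Cf [f' Cf' ff']|f Cf [f' Cf' ff']].
  + exists ('D_v f); first exact/SmoothAlgBase/smooth_on_derive.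
    by move=> x Ux; exact: smooth_on_is_derive Ux.
  + exists (fun x => f' x + g' x); first exact: SmoothAlgD.
    by move=> x Ux; apply: is_deriveD; [exact: ff'|exact: gg'].
  + exists (fun x => f x * g' x + g x * f' x); first
      by apply: SmoothAlgD; apply: SmoothAlgM.
    by move=> x Ux; apply: is_deriveM; [exact: ff'|exact: gg'].
  + exists (fun x => cos (f x) * f' x); first by apply: SmoothAlgM => //; exact: SmoothAlgCos.
    by move=> x Ux; apply: is_derive_chain; exact: ff'.
  + exists (fun x => ((-1) * sin (f x)) * f' x).
      apply: SmoothAlgM => //; apply: SmoothAlgM; last exact: SmoothAlgSin.
      exact/SmoothAlgBase/smooth_on_cst.
    by move=> x Ux; rewrite mulN1r; apply: is_derive_chain; exact: ff'.
Qed.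

Lemma smooth_onD U f g : smooth_on U f -> smooth_on U g ->
  smooth_on U (fun x => f x + g x : R^o).
Proof.
move=> sf sg; apply: smooth_algP; first by case: sf.
by apply: SmoothAlgD; exact: SmoothAlgBase.
Qed.

Lemma smooth_onM U f g : smooth_on U f -> smooth_on U g ->
  smooth_on U (fun x => f x * g x : R^o).
Proof.
move=> sf sg; apply: smooth_algP; first by case: sf.
by apply: SmoothAlgM; exact: SmoothAlgBase.
Qed.

Lemma smooth_on_sin U f : smooth_on U f -> smooth_on U (fun x => sin (f x) : R^o).
Proof.
move=> sf; apply: smooth_algP; first by case: sf.
by apply: SmoothAlgSin; exact: SmoothAlgBase.
Qed.

Lemma smooth_on_cos U f : smooth_on U f -> smooth_on U (fun x => cos (f x) : R^o).
Proof.
move=> sf; apply: smooth_algP; first by case: sf.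
by apply: SmoothAlgCos; exact: SmoothAlgBase.
Qed.

Lemma smooth_onN U f : smooth_on U f -> smooth_on U (fun x => - f x : R^o).
Proof.
move=> sf; rewrite (_ : (fun _ => _) = fun x => (-1) * f x); last first.
  by apply/funext => x; rewrite mulN1r.
exact: (smooth_onM (smooth_on_cst (-1 : R^o) (smooth_on_open sf)) sf).
Qed.

Lemma smooth_onB U f g : smooth_on U f -> smooth_on U g ->
  smooth_on U (fun x => f x - g x : R^o).
Proof. by move=> sf sg; exact: (smooth_onD sf (smooth_onN sg)). Qed.

Lemma smooth_on_sum U n (F : 'I_n -> V -> R^o) : open U ->
  (forall i, smooth_on U (F i)) -> smooth_on U (fun x => \sum_i F i x : R^o).
Proof.
move=> oU; elim: n F => [|n IHn] F sF.
  rewrite (_ : (fun _ => _) = fun=> 0); first exact: smooth_on_cst.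
  by apply/funext => x; rewrite big_ord0.
rewrite (_ : (fun _ => _) = fun x => \sum_(i < n) F (widen_ord (leqnSn n) i) x
    + F ord_max x); last by apply/funext => x; rewrite big_ord_recr.
exact: (smooth_onD (IHn _ (fun i => sF _)) (sF _)).
Qed.

End SmoothAlgebra.

Lemma continuous_mx {R : realType} {T : topologicalType} {m n : nat}
    (F : T -> 'M[R]_(m, n)) x :
  (forall i j, {for x, continuous (fun y => F y i j : R^o)}) ->
  {for x, continuous F}.
Proof.
move=> Fc; apply/cvgrPdist_le => /= e e0; near=> y.
rewrite /Num.Def.normr/= mx_normrE (bigmax_le _ (ltW e0))//= => i _.
rewrite !mxE/=; move: i; near: y; apply: filter_forall => /= i.
exact: ((cvgrPdist_le _ _).1 (Fc i.1 i.2)).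
Unshelve. all: by end_near. Qed.

Section Components.
Context {R : realType} {V : normedModType R} {m n : nat}.
Implicit Types (U : set V) (F : V -> 'M[R]_(m, n)).

Lemma smooth_on_coord U F i j :
  smooth_on U F -> smooth_on U (fun x => F x i j : R^o).
Proof.
move=> sF; apply: (@smooth_on_coind _ _ _ _
  (fun f => exists2 G : V -> 'M[R]_(m, n), smooth_on U G & f = fun x => G x i j)).
- by case: sF.
- move=> _ x [G sG ->] Ux.
  have /= := @continuous_comp _ _ _ G (fun M : 'M[R]_(m, n) => M i j) x.
  by apply; [exact: smooth_on_continuous Ux|exact: coord_continuous].
- move=> _ v [G sG ->].
  exists (fun x => 'D_v G x i j); first by exists ('D_v G); [exact: smooth_on_derive|].
  move=> x Ux; have dG := smooth_on_derivable v sG Ux.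
  apply: DeriveDef; first exact: (derivable_mxP _ _ _).1.
  by rewrite derive_mx // mxE.
- by exists F.
Qed.

Lemma smooth_on_mx U F : open U ->
  (forall i j, smooth_on U (fun x => F x i j : R^o)) -> smooth_on U F.
Proof.
move=> oU; apply: (@smooth_on_coind _ _ _ _
  (fun F => forall i j, smooth_on U (fun x => F x i j : R^o)) oU).
- by move=> G x sG Ux; apply: continuous_mx => i j; exact: smooth_on_continuous Ux.
- move=> G v sG; exists (fun x => \matrix_(i, j) 'D_v (fun y => G y i j : R^o) x).
    move=> i j; rewrite (_ : (fun _ => _) = fun x => 'D_v (fun y => G y i j : R^o) x).
      exact: smooth_on_derive.
    by apply/funext => x; rewrite mxE.
  move=> x Ux; have dG : derivable G x v.
    by apply/derivable_mxP => i j; exact: smooth_on_derivable Ux.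
  by apply: DeriveDef => //; rewrite derive_mx.
Qed.

End Components.

(** * Mean values along lines and the symmetry of second derivatives *)

Section MeanValue.
Context {R : realType} {V : normedModType R}.
Implicit Types (U : set V) (f : V -> R^o).

Lemma is_derive_translate f x v c (df : R) :
  is_derive (c + x) v f df -> is_derive x v (fun y => f (c + y)) df.
Proof.
move=> fd; have -> : x = 0 *: v + x by rewrite scale0r add0r.
apply: (is_derive_line (fun y => f (c + y)) x v df 0).2.
rewrite (_ : (fun _ => _) = fun t : R => f (t *: v + (c + x))); last first.
  by apply/funext => t; rewrite addrCA.
by apply: (is_derive_line f (c + x) v df 0).1; rewrite scale0r add0r.
Qed.

(** Bounding the intermediate time by [|s|] treats both signs of [s] at once, at the price of asking
    for derivability on the symmetric segment. *)
Lemma MVT_line f x v (s : R) :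
  (forall t : R, `|t| <= `|s| -> derivable f (t *: v + x) v) ->
  exists2 t : R, `|t| <= `|s| & f (s *: v + x) - f x = s * 'D_v f (t *: v + x).
Proof.
move=> fd; pose g (t : R) := f (t *: v + x); pose dg t := 'D_v f (t *: v + x).
have gd (t : R) : `|t| <= `|s| -> is_derive t 1 g (dg t).
  by move=> ts; apply: (is_derive_line f x v (dg t) t).1; apply/derivableP/fd.
have gc a b : (forall t : R, t \in `[a, b] -> `|t| <= `|s|) ->
    {within `[a, b], continuous g}.
  move=> abs; apply: derivable_within_continuous => t tab.
  by have [] := gd t (abs t tab).
have g0 : g 0 = f x by rewrite /g scale0r add0r.
have [s0|s0] := leP 0 s.
  have abs (t : R) : t \in `[0, s] -> `|t| <= `|s|.
    by rewrite in_itv /= => /andP[t0 ts]; rewrite !ger0_norm.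
  have [t tab] : exists2 t, t \in `[0, s]%R & g s - g 0 = dg t * (s - 0).
    apply: MVT_segment => // [t tab|]; last exact: gc.
    by apply: gd; apply: abs; exact: subset_itv_oo_cc tab.
  by rewrite g0 subr0 mulrC => E; exists t => //; exact: abs.
have abs (t : R) : t \in `[s, 0] -> `|t| <= `|s|.
  by rewrite in_itv /= => /andP[t0 ts]; rewrite !ler0_norm ?lerN2 // ltW.
have [t tab] : exists2 t, t \in `[s, 0]%R & g 0 - g s = dg t * (0 - s).
  apply: MVT_segment => // [|t tab|]; [exact: ltW| |exact: gc].
  by apply: gd; apply: abs; exact: subset_itv_oo_cc tab.
rewrite g0 sub0r mulrN mulrC => E; exists t; first exact: abs.
by rewrite -[RHS]opprK -E opprB.
Qed.

Let second_difference f x u v (s : R) :=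
  f (s *: u + s *: v + x) - f (s *: u + x) - f (s *: v + x) + f x.

Let second_differenceC f x u v s :
  second_difference f x u v s = second_difference f x v u s.
Proof. by rewrite /second_difference [s *: v + s *: u]addrC; ring. Qed.

(** The property shared by the two iterated derivatives. The second difference is symmetric in [u]
    and [v] but the intermediate point is not, so the two cases give different points of a small
    parallelogram at [x]. *)
Let mean_value_of f x u v (U : set V) (D : V -> R^o) := forall s : R,
  (forall t t' : R, `|t| <= `|s| -> `|t'| <= `|s| -> U (t' *: v + (t *: u + x))) ->
  exists t t', [/\ `|t| <= `|s|, `|t'| <= `|s| &
    second_difference f x u v s = s ^+ 2 * D (t' *: v + (t *: u + x))].

(** The mean value theorem is applied twice: along [u] to the increment of [f] in the direction
    [s *: v], then along [v] to the derivative ['D_u f]. *)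
Let second_difference_mvt U f x u v : smooth_on U f ->
  mean_value_of f x u v U (fun y => 'D_v (fun z => 'D_u f z) y).
Proof.
move=> sf s Ust.
have s0 : `|0 : R| <= `|s| by rewrite normr0.
pose g y := f (s *: v + y) - f y.
have gd (t : R) : `|t| <= `|s| ->
    is_derive (t *: u + x) u g
     ('D_u f (s *: v + (t *: u + x)) - 'D_u f (t *: u + x)).
  move=> ts; apply: is_deriveB; last first.
    apply: smooth_on_is_derive sf _.
    by have := Ust t 0 ts s0; rewrite scale0r add0r.
  by apply: is_derive_translate; apply: smooth_on_is_derive sf _; exact: Ust.
have [t ts E] : exists2 t : R, `|t| <= `|s| &
    g (s *: u + x) - g x = s * 'D_u g (t *: u + x).
  by apply: MVT_line => t ts; have [] := gd t ts.
have [t' t's E'] : exists2 t' : R, `|t'| <= `|s| &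
    'D_u f (s *: v + (t *: u + x)) - 'D_u f (t *: u + x) =
    s * 'D_v (fun y => 'D_u f y) (t' *: v + (t *: u + x)).
  apply: MVT_line => t' t's.
  by apply: smooth_on_derivable (smooth_on_derive u sf) _; exact: Ust.
exists t, t'; split => //.
have [_ dgE] := gd t ts; rewrite expr2 -mulrA -E' -dgE -E /g /second_difference.
rewrite !addrA [s *: v + s *: u]addrC; ring.
Qed.

(** After division by [s ^+ 2], a value of [A] and a value of [B] at points near [x] coincide. By
    continuity [A x] and [B x] then differ by at most any given [e]. *)
Let mean_value_of_uniq f x u v U A B : open U -> U x ->
  {for x, continuous A} -> {for x, continuous B} ->
  mean_value_of f x u v U A -> mean_value_of f x v u U B -> A x = B x.
Proof.
move=> oU Ux Ac Bc mA mB.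
apply/eqP; rewrite -subr_eq0 -normr_le0; apply/ler_addgt0Pr => e e0.
have e20 : 0 < e / 2 by rewrite divr_gt0.
rewrite add0r.
have /nbhs_ballP[d /= d0 close] : \forall y \near x,
    [/\ U y, `|A x - A y| <= e / 2 & `|B x - B y| <= e / 2].
  near=> y; split.
  - by near: y; exact: open_nbhs_nbhs.
  - by near: y; move/cvgrPdist_le : Ac; exact.
  - by near: y; move/cvgrPdist_le : Bc; exact.
(* With this [s] the parallelogram spanned by [s *: u] and [s *: v] at [x] stays in the ball of
   radius [d]; the summand 1 keeps the denominator positive when [u] and [v] both vanish. *)
pose s := d / (2 * (`|u| + `|v| + 1)).
have uv1 : 0 < `|u| + `|v| + 1 by rewrite addrC ltr_pwDl // addr_ge0.
have s0 : 0 < s by rewrite divr_gt0 // mulr_gt0.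
have near_x w w' (t t' : R) : `|w| + `|w'| = `|u| + `|v| -> `|t| <= `|s| -> `|t'| <= `|s| ->
    ball x d (t' *: w' + (t *: w + x)).
  rewrite (gtr0_norm s0) => ww ts t's.
  rewrite -ball_normE /= distrC addrA addrK (le_lt_trans (ler_normD _ _)) // !normrZ.
  apply: (@le_lt_trans _ _ (s * (`|u| + `|v|))).
    by rewrite -ww mulrDr addrC lerD // ler_wpM2r.
  apply: (@lt_le_trans _ _ (s * (`|u| + `|v| + 1))); first by rewrite ltr_pM2l // ltrDl.
  by rewrite /s invfM mulrA mulfVK ?gt_eqF // ler_pdivrMr // ler_peMr ?ler1n // ltW.
have [t t' ts t's|t [t' [ts t's E]]] := mA s.
  by have [] := close _ (near_x u v t t' erefl ts t's).
have [r r' rs r's|r [r' [rs r's F]]] := mB s.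
  by have [] := close _ (near_x v u r r' (addrC _ _) rs r's).
have AB : A (t' *: v + (t *: u + x)) = B (r' *: u + (r *: v + x)).
  have s2 : s ^+ 2 != 0 by rewrite expf_eq0 /= gt_eqF.
  by apply: (mulfI s2); rewrite -E -F second_differenceC.
have [_ cA _] := close _ (near_x u v t t' erefl ts t's).
have [_ _ cB] := close _ (near_x v u r r' (addrC _ _) rs r's).
rewrite (splitr e) -(subrKA (A (t' *: v + (t *: u + x)))).
by rewrite (le_trans (ler_normD _ _)) // lerD // AB distrC.
Unshelve. all: by end_near. Qed.

(* The second difference in the directions u and v is s^2 times a value, near
   the point, of either of the two iterated derivatives. *)
Lemma smooth_on_deriveC U f x u v : smooth_on U f -> U x ->
  'D_u (fun y => 'D_v f y) x = 'D_v (fun y => 'D_u f y) x.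
Proof.
move=> sf Ux.
apply: (mean_value_of_uniq (smooth_on_open sf) Ux _ _
  (second_difference_mvt (x := x) (u := v) (v := u) sf)
  (second_difference_mvt (x := x) (u := u) (v := v) sf)).
- exact: smooth_on_continuous (smooth_on_derive u (smooth_on_derive v sf)) Ux.
- exact: smooth_on_continuous (smooth_on_derive v (smooth_on_derive u sf)) Ux.
Qed.

End MeanValue.

(** * Differentiability of smooth functions on R^n *)

Section SmoothDifferentiable.
Context {R : realType} {n : nat}.
Local Notation E := 'rV[R]_n.
Implicit Types (U : set E) (f : E -> R^o).

Lemma differentiable_intro (V : normedModType R) (g : V -> R^o) x
    (dg : {linear V -> R^o}) : continuous dg ->
  (forall e : R, 0 < e -> \forall h \near 0,
     `|g (h + x) - g x - dg h| <= e * `|h|) -> differentiable g x.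
Proof.
move=> dgc gE.
have gO : g \o shift x = cst (g x) + dg +o_ 0 id.
  apply/eqaddoP => e e0; have := gE e e0; apply: filterS => h /=.
  by rewrite opprD addrA.
have dE := diff_unique dgc gO.
by apply/diff_locallyP; rewrite dE.
Qed.

(** Continuous partial derivatives give differentiability: the increment is split into steps that
    change one coordinate each, and the mean value theorem is applied to every step. *)
Lemma smooth_on_differentiable U f x : smooth_on U f -> U x -> differentiable f x.
Proof.
move=> sf Ux; pose b k : E := delta_mx 0 k.
pose L (h : E) : R^o := \sum_k h 0 k * 'D_(b k) f x.
have Llin : linear L.
  move=> a h h'; rewrite /L scaler_sumr -big_split /=; apply: eq_bigr => k _.
  by rewrite !mxE mulrDl -mulrA.
pose Lm := GRing.isLinear.Build _ _ _ _ L Llin.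
pose LL : {linear E -> R^o} := HB.pack L Lm.
have Lc : continuous LL.
  apply: (@continuous_big _ _ +%R 0 xpredT) => [|k _ h]; first exact: add_continuous.
  have hc : {for h, continuous (fun h : E => h 0 k : R)} by exact: coord_continuous.
  exact: (cvgM hc (cvg_cst _)).
apply: (@differentiable_intro _ _ _ LL Lc) => e e0.
(* Dividing by [n.+1] instead of [n] also covers dimension 0. *)
have e'0 : 0 < e / n.+1%:R by rewrite divr_gt0.
have /nbhs_ballP[d /= d0 close] : \forall y \near x, U y /\
    forall k, `|'D_(b k) f x - 'D_(b k) f y| <= e / n.+1%:R.
  near=> y; split; first by near: y; apply: open_nbhs_nbhs; split => //; case: sf.
  near: y; apply: filter_forall => k.
  have := smooth_on_continuous (smooth_on_derive (b k) sf) Ux.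
  by move/cvgrPdist_le; apply.
near=> h.
have hd : `|h| < d.
  near: h; apply/nbhs_ballP; exists d => // h.
  by rewrite -ball_normE /= sub0r normrN.
have coord_le k : `|h 0 k| <= `|h|.
  by rewrite [leRHS]/Num.norm /= mx_normrE; apply/bigmax_geP; right => /=; exists (0, k).
(* [P k] keeps the first [k] coordinates of [h]. In the maximum norm all intermediate points are no
   farther from [x] than [h + x] is. *)
pose P k : E := \row_j (if (j < k)%N then h 0 j else 0).
have PS (k : 'I_n) : P k.+1 = h 0 k *: b k + P k.
  apply/rowP => j; rewrite !mxE eqxx /= ltnS leq_eqVlt eq_sym.
  have [/eqP jk|jk] := eqVneq (k : nat) j.
    have -> : j = k by apply/val_inj/eqP; rewrite eq_sym.
    by rewrite eqxx ltnn mulr1 addr0.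
  rewrite (_ : (j == k) = false) ?mulr0 ?add0r //.
  by apply: contraNF jk => /eqP ->.
have P_ball (k : 'I_n) (t : R) : `|t| <= `|h 0 k| ->
    ball x d (t *: b k + (P k + x)).
  move=> tk; rewrite -ball_normE /= distrC addrA addrK.
  apply: le_lt_trans hd; rewrite [leLHS]/Num.norm /= mx_normrE; apply: bigmax_le => // -[i j] _ /=.
  rewrite !mxE (ord1 i) eqxx /=; have [->|jk] := eqVneq j k.
    by rewrite ltnn addr0 mulr1 (le_trans tk).
  by rewrite mulr0 add0r; case: ifP => // _; rewrite normr0.
have step (k : 'I_n) : exists c : R,
    `|'D_(b k) f x - c| <= e / n.+1%:R /\
    f (P k.+1 + x) - f (P k + x) = h 0 k * c.
  have [t tk E1] := @MVT_line _ _ f (P k + x) (b k) (h 0 k)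
    (fun t tk => smooth_on_derivable (b k) sf (close _ (P_ball k t tk)).1).
  exists ('D_(b k) f (t *: b k + (P k + x))).
  by rewrite PS -addrA; split => //; apply: (close _ (P_ball k t tk)).2.
have /choice[c cE] := step.
have -> : f (h + x) - f x = \sum_(k < n) h 0 k * c k.
  have -> : h = P n by apply/rowP => j; rewrite mxE ltn_ord.
  have P0 : P 0%N = 0 by apply/rowP => j; rewrite !mxE.
  rewrite -[X in _ - f X]add0r -P0 -(telescope_sumr (fun k => f (P k + x)) (leq0n n)).
  rewrite big_mkord; apply: eq_bigr => k _; rewrite (cE k).2; congr (_ * _).
  by rewrite mxE ltn_ord.
rewrite /= /L -sumrB (le_trans (ler_norm_sum _ _ _)) //.
apply: (@le_trans _ _ (\sum_(k < n) e / n.+1%:R * `|h|)).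
  apply: ler_sum => k _; rewrite -mulrBr normrM mulrC distrC ler_pM //.
  exact: (cE k).1.
rewrite sumr_const card_ord -mulrnAl ler_wpM2r //.
by rewrite -mulrnAl ler_pdivrMr // -[_ *+ _]mulr_natr ler_pM2l // ler_nat.
Unshelve. all: by end_near. Qed.

(** Turns a derivative in a direction that varies with the point into a combination of derivatives
    in fixed directions, to which smoothness and continuity apply. *)
Lemma smooth_on_derive_sum U f x w : smooth_on U f -> U x ->
  'D_w f x = \sum_k w 0 k * 'D_(delta_mx 0 k) f x.
Proof.
move=> sf Ux; have df := smooth_on_differentiable sf Ux.
rewrite deriveE // {1}[w]row_sum_delta linear_sum; apply: eq_bigr => k _.
by rewrite linearZ /= deriveE.
Qed.

Lemma smooth_on_chain U f (c : R -> E) s (dc : E) : smooth_on U f -> U (c s) ->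
  is_derive s 1 c dc -> is_derive s 1 (fun t => f (c t)) ('D_dc f (c s)).
Proof.
move=> sf Uc [cd <-]; have df := smooth_on_differentiable sf Uc.
have dcs : differentiable c s by apply/derivable1_diffP.
have dfc : differentiable (f \o c) s by apply: differentiable_comp.
apply: DeriveDef; first by apply/derivable1_diffP.
by rewrite (_ : (fun _ => _) = f \o c) // !deriveE // diff_comp.
Qed.

End SmoothDifferentiable.

(** * Integrals over boxes *)

Section BoxIntegral.
Context {R : realType}.

(* A Caratheodory function is the pointwise limit of its compositions with the
   rounding of the second variable to multiples of 1/(n+1). *)
Lemma measurable_fun_caratheodory d (T : measurableType d) (f : T * R -> R) :
  (forall y, measurable_fun setT (fun x => f (x, y))) ->
  (forall x, continuous (fun y => f (x, y))) ->
  measurable_fun setT f.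
Proof.
move=> mf cf.
pose r n (y : R) : R := (Num.floor (n.+1%:R * y))%:~R / n.+1%:R.
have n0 n : (0 : R) < n.+1%:R by rewrite ltr0n.
apply: (@measurable_fun_cvg _ _ _ _ (fun n xy => f (xy.1, r n xy.2))).
- move=> n; move=> _ Y mY; rewrite setTI.
  rewrite (_ : _ @^-1` _ = \bigcup_(k : int)
     ((fun x => f (x, k%:~R / n.+1%:R)) @^-1` Y `*`
      `[k%:~R / n.+1%:R, (k + 1)%:~R / n.+1%:R[ )); last first.
    apply/seteqP; split => [[x y] /= Yxy|[x y] [k _] [/= Yx]].
      exists (Num.floor (n.+1%:R * y)) => //; split => //=.
      rewrite in_itv /= ler_pdivrMr // ltr_pdivlMr // mulrC.
      by rewrite ge_floor lt_succ_floor.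
    rewrite in_itv /= ler_pdivrMr // ltr_pdivlMr // mulrC => /floor_def E.
    by rewrite /r E.
  apply: countable_bigcupT_measurable => // k; apply: measurableX => //.
  by rewrite -[X in measurable X]setTI; exact: mf.
- move=> [x y] _ /=; apply: (cvg_comp (fun n => r n y) (fun z => f (x, z))) (cf x y).
  apply/cvgrPdist_le => e e0.
  near=> n.
  have -> : y - r n y = (n.+1%:R * y - (Num.floor (n.+1%:R * y))%:~R) / n.+1%:R.
    by rewrite mulrBl mulrAC mulfV ?gt_eqF // mul1r.
  rewrite ger0_norm; last by rewrite divr_ge0 ?ler0n // subr_ge0 ge_floor.
  rewrite ler_pdivrMr //; apply: (@le_trans _ _ 1).
    by rewrite lerBlDr ltW // addrC -intrD1 lt_succ_floor.
  rewrite -ler_pdivrMl // mulr1 (@le_trans _ _ n%:R) ?ler_nat //.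
  by near: n; exact: nbhs_infty_ger.
Unshelve. all: by end_near. Qed.

Lemma continuous_pairl {X Y : topologicalType} (y : Y) :
  continuous (fun x : X => (x, y)).
Proof. by move=> x; apply: cvg_pair; [exact: cvg_id|exact: cvg_cst]. Qed.

Lemma continuous_pairr {X Y : topologicalType} (x : X) :
  continuous (fun y : Y => (x, y)).
Proof. by move=> y; apply: cvg_pair; [exact: cvg_cst|exact: cvg_id]. Qed.

(** The sigma-algebra here is the product one, so the argument goes through Caratheodory functions
    and not through preimages of open sets. *)
Lemma continuous_measurable_fun2 (f : R * R -> R) :
  continuous f -> measurable_fun setT f.
Proof.
move=> cf; apply: measurable_fun_caratheodory => [y|x].
  apply: continuous_measurable_fun => x.
  exact: (@continuous_comp _ _ _ (fun z => (z, y)) f x (@continuous_pairl _ _ y x) (cf _)).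
by move=> y; exact: (@continuous_comp _ _ _ (fun z => (x, z)) f y (@continuous_pairr _ _ x y) (cf _)).
Qed.

Lemma continuous_measurable_fun3 (f : R * R * R -> R) :
  continuous f -> measurable_fun setT f.
Proof.
move=> cf; apply: measurable_fun_caratheodory => [y|x].
  apply: continuous_measurable_fun2 => x.
  exact: (@continuous_comp _ _ _ (fun z => (z, y)) f x (@continuous_pairl _ _ y x) (cf _)).
by move=> y; exact: (@continuous_comp _ _ _ (fun z => (x, z)) f y (@continuous_pairr _ _ x y) (cf _)).
Qed.

Section Fubini0.
Context d1 d2 (T1 : measurableType d1) (T2 : measurableType d2).
Variables (m1 : {sigma_finite_measure set T1 -> \bar R})
  (m2 : {sigma_finite_measure set T2 -> \bar R}).
Variables (A : set T1) (B : set T2) (f : T1 * T2 -> R).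
Hypotheses (mA : measurable A) (mB : measurable B).
Hypothesis intf : (m1 \x m2)%E.-integrable (A `*` B) (EFin \o f).

Let intfAB : (m1 \x m2)%E.-integrable setT ((EFin \o f) \_ (A `*` B)).
Proof. by apply/(integrable_mkcond _ (measurableX mA mB)). Qed.

(** Fubini's theorem for the extension of [f] by 0 outside the rectangle. *)
Lemma integral_setX_eq0r :
  (forall x, A x -> (\int[m2]_(y in B) (f (x, y))%:E = 0)%E) ->
  (\int[m1 \x m2]_(z in A `*` B) (f z)%:E = 0)%E.
Proof.
move=> f0; rewrite integral_mkcond -(integral12_prod_meas1 intfAB).
apply: integral0_eq => x _; have [Ax|nAx] := pselect (A x).
  rewrite /fubini_F -(f0 x Ax) [RHS]integral_mkcond; apply: eq_integral => y _.
  by rewrite !patchE in_setX /= (mem_set Ax).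
rewrite /fubini_F integral0_eq // => y _.
by rewrite patchE in_setX /= (memNset nAx).
Qed.

Lemma integral_setX_eq0l :
  (forall y, B y -> (\int[m1]_(x in A) (f (x, y))%:E = 0)%E) ->
  (\int[m1 \x m2]_(z in A `*` B) (f z)%:E = 0)%E.
Proof.
move=> f0; rewrite integral_mkcond -(integral21_prod_meas1 intfAB).
apply: integral0_eq => y _; have [By|nBy] := pselect (B y).
  rewrite /fubini_G -(f0 y By) [RHS]integral_mkcond; apply: eq_integral => x _.
  by rewrite !patchE in_setX /= (mem_set By) andbT.
rewrite /fubini_G integral0_eq // => x _.
by rewrite patchE in_setX /= (memNset nBy) andbF.
Qed.

End Fubini0.

Section Fubini3.
Context d1 d2 d3 (T1 : measurableType d1) (T2 : measurableType d2)
  (T3 : measurableType d3).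
Variables (m1 : {sigma_finite_measure set T1 -> \bar R})
  (m2 : {sigma_finite_measure set T2 -> \bar R})
  (m3 : {sigma_finite_measure set T3 -> \bar R}).

(* Packed by hand because the instance inferred on a product of measures is the
   one for subprobabilities. *)
Let m12 : {sigma_finite_measure set (T1 * T2)%type -> \bar R} :=
  HB.pack (m1 \x m2)%E (Measure_isSigmaFinite.Build _ _ _ (m1 \x m2)%E
    (lebesgue_integral_fubini.product_measure_sigma_finite_subproof m1 m2)).

Variables (A : set T1) (B : set T2) (C : set T3) (f : T1 * T2 * T3 -> R).
Hypotheses (mA : measurable A) (mB : measurable B) (mC : measurable C).
Hypothesis intf : (m1 \x m2 \x m3)%E.-integrable (A `*` B `*` C) (EFin \o f).
(** The integral over a slice is itself treated by Fubini's theorem, which requires the slice to be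
    integrable. Integrability of [f] gives this for almost every [z] only; a continuous [f] on a
    bounded box satisfies it for all. *)
Hypothesis intf2 : forall z,
  (m1 \x m2)%E.-integrable (A `*` B) (EFin \o (fun xy => f (xy, z))).

Let mAB : measurable (A `*` B). Proof. exact: measurableX. Qed.

Lemma integral_setX3_eq0_fst :
  (forall y z, (\int[m1]_(x in A) (f (x, y, z))%:E = 0)%E) ->
  (\int[m1 \x m2 \x m3]_(u in A `*` B `*` C) (f u)%:E = 0)%E.
Proof.
move=> f0; apply: (@integral_setX_eq0l _ _ _ _ m12 m3 _ _ f mAB mC intf) => z _.
by apply: (integral_setX_eq0l mA mB (@intf2 z)) => y _; exact: f0.
Qed.

Lemma integral_setX3_eq0_snd :
  (forall x z, (\int[m2]_(y in B) (f (x, y, z))%:E = 0)%E) ->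
  (\int[m1 \x m2 \x m3]_(u in A `*` B `*` C) (f u)%:E = 0)%E.
Proof.
move=> f0; apply: (@integral_setX_eq0l _ _ _ _ m12 m3 _ _ f mAB mC intf) => z _.
by apply: (integral_setX_eq0r mA mB (@intf2 z)) => x _; exact: f0.
Qed.

Lemma integral_setX3_eq0_thd :
  (forall x y, (\int[m3]_(z in C) (f (x, y, z))%:E = 0)%E) ->
  (\int[m1 \x m2 \x m3]_(u in A `*` B `*` C) (f u)%:E = 0)%E.
Proof.
move=> f0; apply: (@integral_setX_eq0r _ _ _ _ m12 m3 _ _ f mAB mC intf) => -[x y] _.
exact: f0.
Qed.

Lemma measure_setX3 :
  ((m1 \x m2 \x m3) (A `*` B `*` C) = m1 A * m2 B * m3 C)%E.
Proof.
transitivity (m12 (A `*` B) * m3 C)%E.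
  exact: (@product_measure1E _ _ _ _ _ m12 m3).
by congr (_ * _)%E; exact: (@product_measure1E _ _ _ _ _ m1 m2).
Qed.

End Fubini3.

End BoxIntegral.

Lemma compact_bound {R : realType} {T : topologicalType} (K : set T) (f : T -> R) :
  compact K -> {in K, continuous f} ->
  exists M, forall x, K x -> `|f x| <= M.
Proof.
move=> cK cf.
have /compact_bounded[M [_ hM]] := continuous_compact (continuous_in_subspaceT cf) cK.
by exists (M + 1) => x Kx; apply: hM; [rewrite ltrDl|exists x].
Qed.

(** * Continuous functions on a box, and derivatives under the integral *)

Section Box.
Context {R : realType}.
Local Notation mu := (@lebesgue_measure R).
Local Notation mu2 := (mu \x mu)%E.
Local Notation mu3 := (mu \x mu \x mu)%E.
Variables a0 b0 a1 b1 a2 b2 : R.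
Hypotheses (ab0 : a0 < b0) (ab1 : a1 < b1) (ab2 : a2 < b2).

Let I0 : set R := `]a0, b0[.
Let I1 : set R := `]a1, b1[.
Let I2 : set R := `]a2, b2[.
Let box : set (R * R * R) := (I0 `*` I1) `*` I2.
Let cbox : set (R * R * R) := (`[a0, b0] `*` `[a1, b1]) `*` `[a2, b2].

Lemma compact_cbox : compact cbox.
Proof. by apply: compact_setX; [apply: compact_setX|]; exact: segment_compact. Qed.

Lemma sub_cbox : box `<=` cbox.
Proof.
by move=> [[x y] z] [[/= x0 y0] z0]; split; [split|]; exact: subset_itv_oo_cc.
Qed.

Let measurable_rect : measurable (I0 `*` I1).
Proof. by apply: measurableX; exact: measurable_itv. Qed.

Lemma measurable_box : measurable box.
Proof. by apply: measurableX => //; exact: measurable_itv. Qed.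

Let measure_rect : mu2 (I0 `*` I1) = ((b0 - a0) * (b1 - a1))%:E.
Proof.
transitivity (mu I0 * mu I1)%E.
  by refine (product_measure1E _ _ _ _); exact: measurable_itv.
by rewrite /I0 /I1 !lebesgue_measure_itv /= !lte_fin ab0 ab1 -!EFinB -EFinM.
Qed.

Lemma measure_box : mu3 box = ((b0 - a0) * (b1 - a1) * (b2 - a2))%:E.
Proof.
transitivity (mu I0 * mu I1 * mu I2)%E.
  by apply: measure_setX3; exact: measurable_itv.
rewrite /I0 /I1 /I2 !lebesgue_measure_itv /= !lte_fin ab0 ab1 ab2.
by rewrite -!EFinB -!EFinM.
Qed.

Lemma continuous_box_integrable f : continuous f -> mu3.-integrable box (EFin \o f).
Proof.
move=> cf; apply: measurable_bounded_integrable.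
- exact: measurable_box.
- have fin : (mu3 box < +oo)%E by rewrite measure_box ltry.
  exact: fin.
- by apply: measurable_funTS; exact: continuous_measurable_fun3.
- have [M hM] := compact_bound compact_cbox (in1W cf).
  exists M; split; first exact: num_real.
  by move=> x Mx u /sub_cbox/hM/le_trans; apply; exact: ltW.
Qed.

Lemma continuous_rect_integrable (f : R * R -> R) :
  continuous f -> mu2.-integrable (I0 `*` I1) (EFin \o f).
Proof.
move=> cf; apply: measurable_bounded_integrable.
- exact: measurable_rect.
- have fin : (mu2 (I0 `*` I1) < +oo)%E by rewrite measure_rect ltry.
  exact: fin.
- by apply: measurable_funTS; exact: continuous_measurable_fun2.
- have cK : compact (`[a0, b0] `*` `[a1, b1] : set (R * R)).
    by apply: compact_setX; exact: segment_compact.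
  have [M hM] := compact_bound cK (in1W cf).
  exists M; split; first exact: num_real.
  move=> x Mx [y z] [/= y0 z0]; apply: (@le_trans _ _ M); last exact: ltW.
  by apply: hM; split; exact: subset_itv_oo_cc.
Qed.

Lemma integral_derive_eq0 (a b : R) (F f : R -> R) : a < b -> continuous f ->
  (forall x : R, is_derive x 1 F (f x)) -> F a = F b ->
  (\int[mu]_(x in `]a, b[) (f x)%:E = 0)%E.
Proof.
move=> ab cf Ff Fab.
have mf A : measurable_fun A (EFin \o f).
  by apply/measurable_EFinP; apply: measurable_funTS; exact: continuous_measurable_fun.
have cF : continuous F.
  by move=> x; apply: differentiable_continuous; apply/derivable1_diffP; have [] := Ff x.
rewrite integral_itv_bndo_bndc // integral_itv_obnd_cbnd //.
rewrite (@continuous_FTC2 _ f F) // ?Fab ?subee //.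
- exact: continuous_subspaceT.
- split.
  + by move=> x _; have [] := Ff x.
  + by apply: cvg_at_right_filter; exact: cF.
  + by apply: cvg_at_left_filter; exact: cF.
- by move=> x _; rewrite derive1E; have [] := Ff x.
Qed.

Section Zero.
Variable f : R * R * R -> R.
Hypothesis cf : continuous f.

Let cf_slice z : continuous (fun xy => f (xy, z)).
Proof.
move=> xy.
exact: (@continuous_comp _ _ _ (fun x => (x, z)) f xy (@continuous_pairl _ _ z xy) (@cf _)).
Qed.

Lemma integral_box_eq0_fst :
  (forall y z, (\int[mu]_(x in I0) (f (x, y, z))%:E = 0)%E) ->
  \int[mu3]_(u in box) f u = 0.
Proof.
move=> f0; rewrite /Rintegral (_ : integral _ _ _ = 0%E) //.
apply: (@integral_setX3_eq0_fst R _ _ _ _ _ _ mu mu mu I0 I1 I2 f) f0.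
- exact: measurable_itv.
- exact: measurable_itv.
- exact: measurable_itv.
- exact: (continuous_box_integrable cf).
- by move=> z; exact: (continuous_rect_integrable (@cf_slice z)).
Qed.

Lemma integral_box_eq0_snd :
  (forall x z, (\int[mu]_(y in I1) (f (x, y, z))%:E = 0)%E) ->
  \int[mu3]_(u in box) f u = 0.
Proof.
move=> f0; rewrite /Rintegral (_ : integral _ _ _ = 0%E) //.
apply: (@integral_setX3_eq0_snd R _ _ _ _ _ _ mu mu mu I0 I1 I2 f) f0.
- exact: measurable_itv.
- exact: measurable_itv.
- exact: measurable_itv.
- exact: (continuous_box_integrable cf).
- by move=> z; exact: (continuous_rect_integrable (@cf_slice z)).
Qed.

Lemma integral_box_eq0_thd :
  (forall x y, (\int[mu]_(z in I2) (f (x, y, z))%:E = 0)%E) ->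
  \int[mu3]_(u in box) f u = 0.
Proof.
move=> f0; rewrite /Rintegral (_ : integral _ _ _ = 0%E) //.
apply: (@integral_setX3_eq0_thd R _ _ _ _ _ _ mu mu mu I0 I1 I2 f) f0.
- exact: measurable_itv.
- exact: measurable_itv.
- exact: measurable_itv.
- exact: (continuous_box_integrable cf).
Qed.

End Zero.

Lemma is_derive_integral_box (f df : R -> R * R * R -> R) (e M : R) :
  (forall t, `|t| < e -> continuous (f t)) ->
  (forall (t : R) u, `|t| < e -> box u -> is_derive t 1 (f^~ u) (df t u)) ->
  (forall t u, `|t| < e -> box u -> `|df t u| <= M) ->
  forall t : R, `|t| < e ->
  is_derive t 1 (fun t => \int[mu3]_(u in box) f t u : R) (\int[mu3]_(u in box) df t u).
Proof.
move=> cf dfE dfM t te.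
have Iin (s : R) : (`](- e), e[%classic : set R) s = (`|s| < e) by rewrite /= in_itv /= ltr_norml.
have intf (s : R) : (`](- e), e[%classic : set R) s -> mu3.-integrable box (EFin \o f s).
  by rewrite Iin => se; exact/continuous_box_integrable/cf.
have derf (s : R) u : (`](- e), e[%classic : set R) s -> box u -> derivable (f ^~ u) s 1.
  by rewrite Iin => se bu; have [] := dfE s u se bu.
have d1E (s : R) u : (`](- e), e[%classic : set R) s -> box u -> partial1of2 f s u = df s u.
  by rewrite Iin partial1of2E => se bu; have [] := dfE s u se bu.
(* The dominating function has to be nonnegative, which is not assumed of [M]. *)
have intM : mu3.-integrable box (EFin \o (fun=> Num.max 0 M)).
  by apply: continuous_box_integrable => u; exact: cvg_cst.
have ub (s : R) u : (`](- e), e[%classic : set R) s -> box u -> `|partial1of2 f s u| <= Num.max 0 M.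
  move=> se bu; rewrite d1E // le_max; apply/orP; right.
  by apply: dfM => //; rewrite -Iin.
have te' : (`](- e), e[%classic : set R) t by rewrite Iin.
have M0 (u : R * R * R) : 0 <= Num.max 0 M by rewrite le_max lexx.
have mb : measurable (box : set (measurableTypeR R * measurableTypeR R * measurableTypeR R)%type)
  by exact: measurable_box.
apply: DeriveDef.
  exact: (derivable_under_integral mb te' intf derf M0 intM ub).
rewrite -derive1E (differentiation_under_integral mb te' intf derf M0 intM ub).
by apply: eq_Rintegral => u; rewrite inE => bu; rewrite d1E.
Qed.

End Box.

(** * The frame and the Levi-Civita connection *)

Section Frame.
Context {R : realType}.
Local Notation E := 'rV[R]_4.
Implicit Types (p q u v w X Y Z : E) (mu : R).

Lemma dotE u v : dot u v = u 0 0 * v 0 0 + u 0 1 * v 0 1 + u 0 2 * v 0 2 + u 0 3 * v 0 3.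
Proof.
rewrite /dot !big_ord_recl big_ord0 addr0 !addrA.
by congr (_ + _ * _ + _ * _ + _ * _); congr (_ 0 _); apply/val_inj.
Qed.

Lemma vec4E (a b c d : R) : ((vec4 a b c d 0 0 = a) * (vec4 a b c d 0 1 = b) *
  (vec4 a b c d 0 2 = c) * (vec4 a b c d 0 3 = d))%type.
Proof. by rewrite /vec4 !mxE. Qed.

Lemma ord4P (P : 'I_4 -> Prop) : P 0 -> P 1 -> P 2 -> P 3 -> forall i, P i.
Proof.
move=> P0 P1 P2 P3 [[|[|[|[|//]]]] i].
- by rewrite (_ : Ordinal i = 0) //; apply/val_inj.
- by rewrite (_ : Ordinal i = 1) //; apply/val_inj.
- by rewrite (_ : Ordinal i = 2) //; apply/val_inj.
- by rewrite (_ : Ordinal i = 3) //; apply/val_inj.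
Qed.

Lemma rV4_eq u v : u 0 0 = v 0 0 -> u 0 1 = v 0 1 -> u 0 2 = v 0 2 -> u 0 3 = v 0 3 -> u = v.
Proof. by move=> h0 h1 h2 h3; apply/rowP; elim/ord4P. Qed.

Lemma frame0 : frame (R := R) 0 = @imul R. Proof. by []. Qed.
Lemma frame1 : frame (R := R) 1 = @jmul R. Proof. by []. Qed.
Lemma frame2 : frame (R := R) 2 = @kmul R. Proof. by []. Qed.
Definition frameE := (frame0, frame1, frame2).

Lemma ord3P (P : 'I_3 -> Prop) : P 0 -> P 1 -> P 2 -> forall i, P i.
Proof.
move=> P0 P1 P2 [[|[|[|//]]] i].
- by rewrite (_ : Ordinal i = 0) //; apply/val_inj.
- by rewrite (_ : Ordinal i = 1) //; apply/val_inj.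
- by rewrite (_ : Ordinal i = 2) //; apply/val_inj.
Qed.

Lemma sum3 (F : 'I_3 -> R) : \sum_i F i = F 0 + F 1 + F 2.
Proof.
rewrite !big_ord_recl big_ord0 addr0 !addrA.
by congr (_ + F _ + F _); apply/val_inj.
Qed.

Lemma frame_linear i (a : R) u v : frame i (a *: u + v) = a *: frame i u + frame i v.
Proof.
by elim/ord3P: i; rewrite !frameE; apply: rV4_eq; rewrite !(vec4E, mxE) //=; ring.
Qed.

Lemma dotDl u v w : dot (u + v) w = dot u w + dot v w.
Proof. rewrite !dotE !mxE; ring. Qed.

Lemma dotC u v : dot u v = dot v u.
Proof. rewrite !dotE; ring. Qed.

Lemma dotZl (a : R) u w : dot (a *: u) w = a * dot u w.
Proof. rewrite !dotE !mxE; ring. Qed.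

Lemma dot_frame_self i p : dot (frame i p) p = 0.
Proof. by elim/ord3P: i; rewrite !frameE dotE !vec4E; ring. Qed.

Lemma dot_frame i j p : dot (frame i p) (frame j p) = (i == j)%:R * dot p p.
Proof. by elim/ord3P: i; elim/ord3P: j; rewrite !frameE !dotE !vec4E /=; ring. Qed.

(** Off S^3 the map [hor] is not a projection, which explains the term [dot p p]; on S^3 the
    coefficient is [mu - 1]. The formula on all of R^4 is what gets differentiated. *)
Lemma bergerE mu p Y Z : berger mu p Y Z =
  dot Y Z + (mu - 2 + dot p p) * (dot Y (imul p) * dot Z (imul p)).
Proof.
rewrite /berger /hor !dotE !mxE /=; ring.
Qed.

(** The vectors p, i p, j p, k p are orthogonal and have the same length as p. The factor [dot p p]
    makes Parseval's identity polynomial, hence valid off S^3 too. *)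
Lemma parseval p Y Z : dot p p * dot Y Z =
  dot Y p * dot Z p + \sum_i dot Y (frame i p) * dot Z (frame i p).
Proof. by rewrite sum3 !frameE !dotE !vec4E; ring. Qed.

Definition frame_weight mu (i : 'I_3) : R := if i == 0 then mu else 1.

Lemma berger_tangent mu p Y Z : S3 p -> dot Y p = 0 ->
  berger mu p Y Z =
  \sum_i frame_weight mu i * (dot Y (frame i p) * dot Z (frame i p)).
Proof.
move=> p1 Yp; have := parseval p Y Z; rewrite bergerE p1 Yp mul0r mul1r add0r => ->.
by rewrite !sum3 /frame_weight !frameE /=; ring.
Qed.

Lemma berger_frame mu i j p : S3 p ->
  berger mu p (frame i p) (frame j p) = (i == j)%:R * frame_weight mu i.
Proof.
move=> p1; rewrite berger_tangent // ?dot_frame_self // sum3 !dot_frame p1.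
by elim/ord3P: i; elim/ord3P: j; rewrite /frame_weight /=; ring.
Qed.

Lemma bergerC mu p Y Z : berger mu p Y Z = berger mu p Z Y.
Proof. by rewrite !bergerE dotC [dot Y _ * _]mulrC. Qed.

Lemma bergerDl mu p X Y Z : berger mu p (X + Y) Z = berger mu p X Z + berger mu p Y Z.
Proof. by rewrite !bergerE !dotDl; ring. Qed.

Lemma bergerZl mu p (a : R) X Z : berger mu p (a *: X) Z = a * berger mu p X Z.
Proof. by rewrite !bergerE !dotZl; ring. Qed.

Lemma bergerBl mu p X Y Z : berger mu p (X - Y) Z = berger mu p X Z - berger mu p Y Z.
Proof. by rewrite -scaleN1r bergerDl bergerZl mulN1r. Qed.

(* The Levi-Civita symbol, as a Vandermonde product. *)
Definition eps3 (i j k : 'I_3) : R :=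
  ((j : nat)%:R - (i : nat)%:R) * ((k : nat)%:R - (j : nat)%:R) *
  ((k : nat)%:R - (i : nat)%:R) / 2.

Lemma ord3_val : (((0 : 'I_3) = 0%N :> nat) * ((1 : 'I_3) = 1%N :> nat) *
  ((2 : 'I_3) = 2%N :> nat))%type.
Proof. by []. Qed.

(** As the frame fields are linear maps, the left side is the Lie bracket of the fields [i] and [j].
    It is opposite to the commutator of the corresponding quaternions, whence the minus sign. *)
Lemma frame_bracket i j p :
  frame j (frame i p) - frame i (frame j p) = \sum_k (- 2 * eps3 i j k) *: frame k p.
Proof.
have sumE (F : 'I_3 -> E) : \sum_i F i = F 0 + F 1 + F 2.
  rewrite !big_ord_recl big_ord0 addr0 !addrA.
  by congr (_ + F _ + F _); apply/val_inj.
by elim/ord3P: i; elim/ord3P: j; rewrite sumE !frameE /eps3 !ord3_val;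
  apply: rV4_eq; rewrite !(vec4E, mxE); field.
Qed.

Lemma berger_bracket mu i j k p : S3 p ->
  berger mu p (frame j (frame i p) - frame i (frame j p)) (frame k p) =
  - 2 * eps3 i j k * frame_weight mu k.
Proof.
move=> p1; rewrite frame_bracket bergerC.
have lin (F : 'I_3 -> E) : berger mu p (frame k p) (\sum_l F l) =
    \sum_l berger mu p (frame k p) (F l).
  elim/big_ind2: _ => // [|a b c d <- <-].
    by rewrite bergerE !dotE !mxE; ring.
  by rewrite ![berger _ _ (frame k p) _]bergerC bergerDl.
rewrite lin (bigD1 k) //= big1 ?addr0 => [|l lk].
  by rewrite bergerC bergerZl berger_frame // eqxx mul1r.
by rewrite bergerC bergerZl berger_frame // (negbTE lk) mul0r mulr0.
Qed.

Lemma is_derive_frame i p v : is_derive p v (frame i) (frame i v).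
Proof.
have -> : p = 0 *: v + p by rewrite scale0r add0r.
apply: (is_derive_line (frame i) p v (frame i v) 0).2.
rewrite (_ : (fun _ => _) = (fun t : R => t *: frame i v + frame i p)); last first.
  by apply/funext => t; rewrite frame_linear.
apply: (is_derive_line id (frame i p) (frame i v) (frame i v) 0).1.
Qed.

End Frame.

(** * The connection and the trace of L in the frame *)

Section Connection.
Context {R : realType}.
Local Notation E := 'rV[R]_4.
Implicit Types (p q u v w : E) (X Y Z : E -> E) (mu lambda : R).

Lemma smooth_on_frame_comp (V : normedModType R) (U : set V) i (G : V -> E) :
  smooth_on U G -> smooth_on U (fun x => frame i (G x)).
Proof.
move=> sG; have oU := smooth_on_open sG.
apply: smooth_on_mx => // a; rewrite {a}(ord1 a) => j.
have sc k := smooth_on_coord 0 k sG; have sn k := smooth_onN (sc k).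
have vE (a b c d : V -> R^o) : smooth_on U a -> smooth_on U b -> smooth_on U c ->
    smooth_on U d -> smooth_on U (fun y => vec4 (a y) (b y) (c y) (d y) 0 j : R^o).
  move=> sa sb s'c sd.
  have vj (f : V -> R^o) : (forall y, vec4 (a y) (b y) (c y) (d y) 0 j = f y) ->
      smooth_on U f -> smooth_on U (fun y => vec4 (a y) (b y) (c y) (d y) 0 j : R^o).
    by move=> /funext ->.
  elim/ord4P: j vj => vj; [apply: vj sa|apply: vj sb|apply: vj s'c|apply: vj sd] => p;
    by rewrite vec4E.
elim/ord3P: i; rewrite frameE; [exact: (vE _ _ _ _ (sn 1) (sc 0) (sn 3) (sc 2))|
  exact: (vE _ _ _ _ (sn 2) (sc 3) (sc 0) (sn 1))|exact: (vE _ _ _ _ (sn 3) (sn 2) (sc 1) (sc 0))].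
Qed.

Lemma smooth_on_idE (U : set E) : open U -> smooth_on U (fun p : E => p).
Proof. by move=> oU; apply: (smooth_on_linear (l := idfun)) => // x; exact: cvg_id. Qed.

Lemma smooth_on_frame (U : set E) i : open U -> smooth_on U (frame i : E -> E).
Proof. by move=> oU; exact: (smooth_on_frame_comp i (smooth_on_idE oU)). Qed.

Lemma smooth_on_dot (V : normedModType R) (U : set V) (G H : V -> E) :
  smooth_on U G -> smooth_on U H -> smooth_on U (fun x => dot (G x) (H x) : R^o).
Proof.
move=> sG sH; apply: smooth_on_sum; first exact: smooth_on_open sG.
by move=> k; exact: (smooth_onM (smooth_on_coord 0 k sG) (smooth_on_coord 0 k sH)).
Qed.

Lemma vector_field_frame i : vector_field (frame i : E -> E).
Proof.
split; first by exists setT => //; apply: smooth_on_frame; exact: openT.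
by move=> p _; exact: dot_frame_self.
Qed.

Lemma smooth_near_derivable (S : set E) X p v :
  smooth_near S X -> S p -> derivable X p v.
Proof. by case=> U SU sX /SU Up; exact: smooth_on_derivable v sX Up. Qed.

Lemma is_derive_dot (V : normedModType R) (X Y : V -> E) (p v : V) dX dY :
  is_derive p v X dX -> is_derive p v Y dY ->
  is_derive p v (fun x => dot (X x) (Y x) : R^o) (dot dX (Y p) + dot (X p) dY).
Proof.
move=> [Xd <-] [Yd <-].
have cd (Z : V -> E) i : derivable Z p v -> is_derive p v (fun x => Z x 0 i : R^o) ('D_v Z p 0 i).
  move=> Zd; apply: DeriveDef; first exact: (derivable_mxP _ _ _).1.
  by rewrite derive_mx // mxE.
rewrite (_ : (fun _ => _) = \sum_i (fun x => X x 0 i * Y x 0 i : R^o)); last first.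
  by apply/funext => x; rewrite fct_sumE.
rewrite (_ : _ + _ = \sum_i (X p 0 i * 'D_v Y p 0 i + Y p 0 i * 'D_v X p 0 i)).
  by apply: is_derive_sum => i; apply: is_deriveM; exact: cd.
rewrite /dot -big_split /=; apply: eq_bigr => i _; rewrite addrC; congr (_ + _).
by rewrite mulrC.
Qed.

Lemma is_derive_dot_frame X p v k : derivable X p v ->
  is_derive p v (fun q => dot (X q) (frame k q) : R^o)
    (dot ('D_v X p) (frame k p) + dot (X p) (frame k v)).
Proof. by move=> Xd; apply: is_derive_dot; [exact/derivableP|exact: is_derive_frame]. Qed.

(** Polarization of [dot_frame]. For [u] on S^3 and [v] tangent at [u], it says that scalar products
    of frame fields have derivative 0 along [v]. *)
Lemma dot_frame_polar i j u v : dot (frame i u) (frame j v) + dot (frame i v) (frame j u) =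
  (i == j)%:R * (2 * dot u v).
Proof. by elim/ord3P: i; elim/ord3P: j; rewrite !frameE !dotE !vec4E /=; ring. Qed.

(** For tangent values of [X] the two functions differentiated are proportional on S^3, but not on
    R^4. In [bergerE] the extra factors [dot q q] and [dot (frame k q) (frame 0 q)] have derivative
    0 in tangent directions, so they act as constants. *)
Lemma derive_berger_frame mu X p v k : S3 p -> dot v p = 0 -> derivable X p v ->
  'D_v (fun q => berger mu q (X q) (frame k q) : R^o) p =
  frame_weight mu k * 'D_v (fun q => dot (X q) (frame k q) : R^o) p.
Proof.
move=> p1 vp Xd.
have d1 l := is_derive_dot_frame l Xd.
have d2 : is_derive p v (fun q => dot q q : R^o) 0.
  apply: is_derive_eq (is_derive_dot (is_derive_id p v) (is_derive_id p v)) _.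
  by rewrite [dot p v]dotC vp addr0.
have d3 : is_derive p v (fun q => dot (frame k q) (frame 0 q) : R^o) 0.
  apply: is_derive_eq (is_derive_dot (is_derive_frame k p v) (is_derive_frame 0 p v)) _.
  by rewrite dot_frame_polar vp !mulr0.
pose c (q : E) : R^o := mu - 2 + dot q q.
have d4 : is_derive p v c 0.
  apply: is_derive_eq (is_deriveD (is_derive_cst (mu - 2 : R^o) p v) d2) _.
  by rewrite addr0.
pose D l := dot ('D_v X p) (frame l p) + dot (X p) (frame l v).
have d5 : is_derive p v
    (fun q => dot (X q) (frame 0 q) * dot (frame k q) (frame 0 q) : R^o)
    (dot (X p) (frame 0 p) * 0 + dot (frame k p) (frame 0 p) * D 0).
  by apply: is_deriveM; exact: d1.
have d6 : is_derive p v (fun q => berger mu q (X q) (frame k q) : R^o)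
  (D k + (c p * (dot (X p) (frame 0 p) * 0 + dot (frame k p) (frame 0 p) * D 0) +
     (dot (X p) (frame 0 p) * dot (frame k p) (frame 0 p)) * 0)).
  rewrite (_ : (fun _ => _) = (fun q => dot (X q) (frame k q) +
     c q * (dot (X q) (frame 0 q) * dot (frame k q) (frame 0 q)))); last first.
    by apply/funext => q; rewrite bergerE.
  exact: (is_deriveD (d1 k) (is_deriveM d4 d5)).
have [_ ->] := d6; have [_ ->] := d1 k; rewrite -/(D k) dot_frame /c p1 /frame_weight.
by have [->|_] := eqVneq k 0; rewrite /=; ring.
Qed.

Lemma eps3_swap i j k : eps3 i k j = - eps3 i j k :> R.
Proof. by rewrite /eps3; field. Qed.

Lemma eps3_rot i j k : eps3 j k i = eps3 i j k :> R.
Proof. by rewrite /eps3; field. Qed.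

Lemma frame_weight_gt0 mu i : 0 < mu -> 0 < frame_weight mu i.
Proof. by rewrite /frame_weight; case: ifP. Qed.

Section LeviCivita.
Variables (mu : R) (nabla : (E -> E) -> (E -> E) -> E -> E).
Hypotheses (mu0 : 0 < mu) (hnabla : levi_civita mu nabla).
Let e := @frame R.

Let ve i : vector_field (e i) := vector_field_frame i.

Let derive_frame_weight p i j k : S3 p ->
  'D_(e i p) (fun q => berger mu q (e j q) (e k q) : R^o) p = 0.
Proof.
move=> p1; rewrite derive_berger_frame // ?dot_frame_self //; last first.
  by have [] := is_derive_frame j p (e i p).
have [_ ->] : is_derive p (e i p) (fun q => dot (e j q) (e k q) : R^o)
    (dot (e j (e i p)) (e k p) + dot (e j p) (e k (e i p))).
  by apply: is_derive_dot; exact: is_derive_frame.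
by rewrite dot_frame_polar dot_frame_self !mulr0.
Qed.

(* Koszul's formula for the frame, whose scalar products are constant. *)
Lemma nabla_frame p i j k : S3 p ->
  berger mu p (nabla (e i) (e j) p) (e k p) =
  eps3 i j k * (frame_weight mu i - frame_weight mu j - frame_weight mu k).
Proof.
move=> p1; pose G a b c := berger mu p (nabla (e a) (e b) p) (e c p).
have metric a b c : G a b c + G a c b = 0.
  have := lc_metric hnabla (ve b) (ve c) (ve a) p1.
  by rewrite derive_frame_weight // [X in _ + X]bergerC.
have torsion a b c : G a b c - G b a c = - 2 * eps3 a b c * frame_weight mu c.
  rewrite -(berger_bracket mu a b c p1) /G -bergerBl (lc_torsion_free hnabla (ve a) (ve b) p1).
  have [_ ->] := is_derive_frame b p (e a p).
  by have [_ ->] := is_derive_frame a p (e b p).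
rewrite -/(G i j k).
(* Metric compatibility and vanishing torsion give six linear equations in the six values of [G] at
   the permutations of i, j, k. *)
have h1 := metric i j k; have h2 := metric j i k; have h3 := metric k i j.
have t1 := torsion i j k; have t2 := torsion i k j; have t3 := torsion j k i.
rewrite eps3_swap in t2; rewrite eps3_rot in t3.
lra.
Qed.

Lemma berger_expand p u v : S3 p -> dot u p = 0 -> dot v p = 0 ->
  berger mu p u v = \sum_j dot u (e j p) * berger mu p v (e j p).
Proof.
move=> p1 up vp; rewrite berger_tangent //; apply: eq_bigr => j _.
rewrite berger_tangent // (bigD1 j) //= big1 ?addr0 => [|l lj].
  by rewrite dot_frame eqxx p1 !mul1r mulrCA mulr1.
by rewrite dot_frame eq_sym (negbTE lj) !mul0r !mulr0.
Qed.

Lemma berger_sqr p u : S3 p -> dot u p = 0 ->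
  berger mu p u u = \sum_j (berger mu p u (e j p)) ^+ 2 / frame_weight mu j.
Proof.
move=> p1 up; rewrite berger_expand //; apply: eq_bigr => j _.
suff -> : berger mu p u (e j p) = frame_weight mu j * dot u (e j p).
  by rewrite exprMn expr2 -mulrA mulrC; field; rewrite gt_eqF ?frame_weight_gt0.
rewrite berger_tangent // (bigD1 j) //= big1 ?addr0 => [|l lj].
  by rewrite dot_frame eqxx p1 !mulr1.
by rewrite dot_frame eq_sym (negbTE lj) !mul0r !mulr0.
Qed.

(** Metric compatibility is applied to [X] and the frame field [e k]. The term containing the
    derivative of [e k] is known from [nabla_frame], so [X] need not be expanded in the frame under
    the connection. *)
Lemma nabla_coef X p i k : vector_field X -> S3 p ->
  berger mu p (nabla (e i) X p) (e k p) =
  frame_weight mu k * 'D_(e i p) (fun q => dot (X q) (e k q) : R^o) p -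
  \sum_j dot (X p) (e j p) *
    (eps3 i k j * (frame_weight mu i - frame_weight mu k - frame_weight mu j)).
Proof.
move=> vX p1; have := lc_metric hnabla vX (ve k) (ve i) p1.
rewrite derive_berger_frame ?dot_frame_self //; last exact: smooth_near_derivable vX.1 p1.
move=> ->; rewrite [X in _ + X - _]berger_expand //; last 2 first.
- exact: vX.2.
- exact: (lc_field hnabla (ve k) (ve i)).2.
under [X in _ + X - _]eq_bigr do rewrite nabla_frame //.
by rewrite addrK.
Qed.

Lemma gramE lambda p : S3 p -> gram lambda p = diag_mx (\row_i frame_weight lambda i).
Proof.
move=> p1; apply/matrixP => i j; rewrite !mxE berger_frame //.
by rewrite mulr_natl.
Qed.

Lemma trace_L lambda X p : 0 < lambda -> vector_field X -> S3 p ->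
  \tr (L_matrix mu lambda nabla X p) =
  \sum_i (frame_weight lambda i)^-1 * (frame_weight mu i +
    \sum_k (berger mu p (nabla (e i) X p) (e k p)) ^+ 2 / frame_weight mu k).
Proof.
move=> l0 vX p1; rewrite /L_matrix gramE //.
pose w := \row_i frame_weight lambda i; pose w' := \row_i (frame_weight lambda i)^-1.
have lw i : frame_weight lambda i != 0 by rewrite gt_eqF // frame_weight_gt0.
have ww' : diag_mx w' *m diag_mx w = 1%:M :> 'M[R]_3.
  rewrite mulmx_diag -diag_const_mx; congr diag_mx; apply/rowP => j.
  by rewrite !mxE mulVf.
have -> : invmx (diag_mx w) = diag_mx w'.
  have uw : diag_mx w \in unitmx by have [] := mulmx1_unit ww'.
  by rewrite -[LHS]mul1mx -ww' mulmxK.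
rewrite /mxtrace; apply: eq_bigr => i _; rewrite mul_diag_mx !mxE; congr (_ * _).
rewrite /pullback_sasaki berger_frame // eqxx mul1r; congr (_ + _).
by rewrite berger_sqr //; exact: (lc_field hnabla vX (ve i)).2.
Qed.

End LeviCivita.
End Connection.

(** * Hopf coordinates and the divergence theorem *)

Section Chart.
Context {R : realType}.
Local Notation E := 'rV[R]_4.
Implicit Types (u : R * R * R) (x y z : R).

Lemma det_mx33 (A : 'M[R]_3) : \det A =
  A 0 0 * (A 1 1 * A 2 2 - A 1 2 * A 2 1) - A 0 1 * (A 1 0 * A 2 2 - A 1 2 * A 2 0)
  + A 0 2 * (A 1 0 * A 2 1 - A 1 1 * A 2 0).
Proof.
have l00 : lift (0 : 'I_3) (0 : 'I_2) = 1 by apply/val_inj.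
have l01 : lift (0 : 'I_3) (1 : 'I_2) = 2 by apply/val_inj.
have l10 : lift (1 : 'I_3) (0 : 'I_2) = 0 by apply/val_inj.
have l11 : lift (1 : 'I_3) (1 : 'I_2) = 2 by apply/val_inj.
have l20 : lift (2 : 'I_3) (0 : 'I_2) = 0 by apply/val_inj.
have l21 : lift (2 : 'I_3) (1 : 'I_2) = 1 by apply/val_inj.
have det2 (B : 'M[R]_2) : \det B = B 0 0 * B 1 1 - B 0 1 * B 1 0.
  rewrite (expand_det_row B 0) !big_ord_recl big_ord0 addr0 /cofactor !det_mx11 !mxE.
  have -> : lift (0 : 'I_2) (ord0 : 'I_1) = 1 by apply/val_inj.
  have -> : lift (1 : 'I_2) (0 : 'I_1) = 0 by apply/val_inj.
  by rewrite /= ?expr0 ?expr1; ring.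
rewrite (expand_det_row A 0) sum3 /cofactor !det2 !mxE.
by rewrite !l00 !l01 !l10 !l11 !l20 !l21 !ord3_val /=; ring.
Qed.

Lemma is_derive_vec4 (V : normedModType R) (a b c d : V -> R^o) (p v : V) (da db dc dd : R) :
  is_derive p v a da -> is_derive p v b db -> is_derive p v c dc -> is_derive p v d dd ->
  is_derive p v (fun q => vec4 (a q) (b q) (c q) (d q)) (vec4 da db dc dd).
Proof.
move=> [ad <-] [bd <-] [cd <-] [dd' <-].
have aE : (fun q => vec4 (a q) (b q) (c q) (d q) 0 0) = a.
  by apply/funext => q; rewrite vec4E.
have bE : (fun q => vec4 (a q) (b q) (c q) (d q) 0 1) = b.
  by apply/funext => q; rewrite vec4E.
have cE : (fun q => vec4 (a q) (b q) (c q) (d q) 0 2) = c.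
  by apply/funext => q; rewrite vec4E.
have dE : (fun q => vec4 (a q) (b q) (c q) (d q) 0 3) = d.
  by apply/funext => q; rewrite vec4E.
have vd : derivable (fun q => vec4 (a q) (b q) (c q) (d q)) p v.
  apply/derivable_mxP => i j; rewrite (ord1 i).
  by elim/ord4P: j; [rewrite aE; exact: ad|rewrite bE; exact: bd|
    rewrite cE; exact: cd|rewrite dE; exact: dd'].
apply: DeriveDef; first exact: vd.
rewrite derive_mx; last exact: vd.
by apply: rV4_eq; rewrite mxE vec4E; [rewrite aE|rewrite bE|rewrite cE|rewrite dE].
Qed.

Definition hopf_eta x y z : E :=
  vec4 (- sin x * cos y) (- sin x * sin y) (cos x * cos z) (cos x * sin z).
Definition hopf_xi1 x y : E := vec4 (- cos x * sin y) (cos x * cos y) 0 0.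
Definition hopf_xi2 x z : E := vec4 0 0 (- sin x * sin z) (sin x * cos z).

Lemma is_derive_mulr (f : R -> R) x (k df : R) : is_derive x 1 f df ->
  is_derive x 1 (fun t => f t * k) (df * k).
Proof.
move=> fd; apply: is_derive_eq (is_deriveM fd (is_derive_cst k x 1)) _.
by rewrite scaler0 add0r [LHS]mulrC.
Qed.

Lemma is_derive_mull (f : R -> R) x (k df : R) : is_derive x 1 f df ->
  is_derive x 1 (fun t => k * f t) (k * df).
Proof.
move=> fd; rewrite mulrC (_ : (fun _ => _) = fun t => f t * k); first exact: is_derive_mulr.
by apply/funext => t; rewrite mulrC.
Qed.

Lemma is_derive_hopf_eta x y z :
  is_derive x 1 (fun t : R => hopf_chart (t, y, z)) (hopf_eta x y z).
Proof.
by apply: is_derive_vec4; apply: is_derive_mulr.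
Qed.

Lemma is_derive_hopf_xi1 x y z :
  is_derive y 1 (fun t : R => hopf_chart (x, t, z)) (hopf_xi1 x y).
Proof.
rewrite /hopf_xi1 mulNr -mulrN.
by apply: is_derive_vec4; try exact: is_derive_cst; apply: is_derive_mull.
Qed.

Lemma is_derive_hopf_xi2 x y z :
  is_derive z 1 (fun t : R => hopf_chart (x, y, t)) (hopf_xi2 x z).
Proof.
rewrite /hopf_xi2 mulNr -mulrN.
by apply: is_derive_vec4; try exact: is_derive_cst; apply: is_derive_mull.
Qed.

Lemma coord_fieldE x y z : ((coord_field 0 (x, y, z) = hopf_eta x y z) *
  (coord_field 1 (x, y, z) = hopf_xi1 x y) * (coord_field 2 (x, y, z) = hopf_xi2 x z))%type.
Proof.
have H (i : 'I_3) (u : R^o * R^o * R^o) (s : R) dH :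
    is_derive s 1 (fun t : R => hopf_chart (t *: coord_dir R i + u)) dH ->
    coord_field i (s *: coord_dir R i + u) = dH.
  move=> h; have [_ <-] := (is_derive_line (@hopf_chart R : R^o * R^o * R^o -> E)
    u (coord_dir R i) dH s).2 h.
  by [].
have dir (t a b c : R) (i : 'I_3) : t *: coord_dir R i + ((a, b, c) : R^o * R^o * R^o) =
   (t * (i == 0)%:R + a, t * (i == 1)%:R + b, t * (i == 2)%:R + c) by [].
split; [split|].
- have <- : x *: coord_dir R 0 + ((0, y, z) : R^o * R^o * R^o) = (x, y, z).
    by rewrite dir /= mulr1 !mulr0 !add0r addr0.
  apply: H; rewrite (_ : (fun _ => _) = fun t : R => hopf_chart (t, y, z)).
    exact: is_derive_hopf_eta.
  by apply/funext => t; rewrite dir /= mulr1 !mulr0 !add0r addr0.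
- have <- : y *: coord_dir R 1 + ((x, 0, z) : R^o * R^o * R^o) = (x, y, z).
    by rewrite dir /= mulr1 !mulr0 !add0r addr0.
  apply: H; rewrite (_ : (fun _ => _) = fun t : R => hopf_chart (x, t, z)).
    exact: is_derive_hopf_xi1.
  by apply/funext => t; rewrite dir /= mulr1 !mulr0 !add0r addr0.
- have <- : z *: coord_dir R 2 + ((x, y, 0) : R^o * R^o * R^o) = (x, y, z).
    by rewrite dir /= mulr1 !mulr0 !add0r addr0.
  apply: H; rewrite (_ : (fun _ => _) = fun t : R => hopf_chart (x, y, t)).
    exact: is_derive_hopf_xi2.
  by apply/funext => t; rewrite dir /= mulr1 !mulr0 !add0r addr0.
Qed.

Lemma S3_hopf u : S3 (hopf_chart u).
Proof.
move: u => [[x y] z]; rewrite /S3 /= dotE !vec4E.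
have hx := cos2Dsin2 x; have hy := cos2Dsin2 y; have hz := cos2Dsin2 z.
transitivity (cos x ^+ 2 * (cos y ^+ 2 + sin y ^+ 2) + sin x ^+ 2 * (cos z ^+ 2 + sin z ^+ 2)).
  by ring.
by rewrite hy hz !mulr1.
Qed.

(** In Hopf coordinates V is the sum of the two angular coordinate fields. Scaling g(V, V) by lambda
    scales the round density cos eta sin eta by the square root of lambda; the restriction to the
    chart domain makes this product nonnegative. *)
Lemma volume_densityE lambda u : 0 < lambda -> hopf_chart_dom u ->
  volume_density lambda u = Num.sqrt lambda * (cos u.1.1 * sin u.1.1).
Proof.
move: u => [[x y] z] l0 [[/= xI yI] zI].
have x0 : 0 <= cos x * sin x.
  move: xI; rewrite in_itv /= => /andP[x0 x1]; rewrite mulr_ge0 // ltW //.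
    by apply: cos_gt0_pihalf; rewrite x1 andbT (lt_trans _ x0) // oppr_lt0 divr_gt0 // pi_gt0.
  by apply: sin_gt0_pihalf; rewrite x0.
rewrite /volume_density; have -> : \det (\matrix_(i < 3, j < 3) berger lambda (hopf_chart (x, y, z))
    (coord_field i (x, y, z)) (coord_field j (x, y, z))) = lambda * (cos x * sin x) ^+ 2.
  have := S3_hopf (x, y, z); rewrite /S3 /= => p1.
  rewrite det_mx33 !mxE !coord_fieldE !bergerE p1.
  have hx := cos2Dsin2 x; have hy := cos2Dsin2 y; have hz := cos2Dsin2 z.
  have -> : dot (hopf_eta x y z) (imul (hopf_chart (x, y, z))) = 0.
    by rewrite dotE !vec4E; ring.
  have -> : dot (hopf_xi1 x y) (imul (hopf_chart (x, y, z))) = cos x ^+ 2.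
    rewrite dotE !vec4E; transitivity (cos x ^+ 2 * (cos y ^+ 2 + sin y ^+ 2)); first by ring.
    by rewrite hy mulr1.
  have -> : dot (hopf_xi2 x z) (imul (hopf_chart (x, y, z))) = sin x ^+ 2.
    rewrite dotE !vec4E; transitivity (sin x ^+ 2 * (cos z ^+ 2 + sin z ^+ 2)); first by ring.
    by rewrite hz mulr1.
  have -> : dot (hopf_eta x y z) (hopf_eta x y z) = 1.
    rewrite dotE !vec4E -[RHS]hx; transitivity (sin x ^+ 2 * (cos y ^+ 2 + sin y ^+ 2)
      + cos x ^+ 2 * (cos z ^+ 2 + sin z ^+ 2)); first by ring.
    by rewrite hy hz !mulr1 addrC.
  have -> : dot (hopf_eta x y z) (hopf_xi1 x y) = 0 by rewrite dotE !vec4E; ring.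
  have -> : dot (hopf_eta x y z) (hopf_xi2 x z) = 0 by rewrite dotE !vec4E; ring.
  have -> : dot (hopf_xi1 x y) (hopf_eta x y z) = 0 by rewrite dotE !vec4E; ring.
  have -> : dot (hopf_xi2 x z) (hopf_eta x y z) = 0 by rewrite dotE !vec4E; ring.
  have -> : dot (hopf_xi1 x y) (hopf_xi2 x z) = 0 by rewrite dotE !vec4E; ring.
  have -> : dot (hopf_xi2 x z) (hopf_xi1 x y) = 0 by rewrite dotE !vec4E; ring.
  have -> : dot (hopf_xi1 x y) (hopf_xi1 x y) = cos x ^+ 2.
    rewrite dotE !vec4E; transitivity (cos x ^+ 2 * (cos y ^+ 2 + sin y ^+ 2)); first by ring.
    by rewrite hy mulr1.
  have -> : dot (hopf_xi2 x z) (hopf_xi2 x z) = sin x ^+ 2.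
    rewrite dotE !vec4E; transitivity (sin x ^+ 2 * (cos z ^+ 2 + sin z ^+ 2)); first by ring.
    by rewrite hz mulr1.
  move: (cos x) (sin x) hx => c s hx.
  have -> : s ^+ 2 = 1 - c ^+ 2 by rewrite -hx addrC addKr.
  have -> : (c * s) ^+ 2 = c ^+ 2 * (1 - c ^+ 2) by rewrite exprMn -hx [c ^+ 2 + _]addrC addrK.
  by ring.
by rewrite sqrtrM ?ltW // sqrtr_sqr ger0_norm.
Qed.

End Chart.

(** * The divergence theorem for the fields j p and k p *)

Section Divergence.
Context {R : realType}.
Local Notation E := 'rV[R]_4.
Local Notation mu3 := (@lebesgue_measure R \x @lebesgue_measure R \x @lebesgue_measure R)%E.
Local Notation T := (R * R * R)%type.
Implicit Types (u : T) (x y z : R) (f g : T -> R).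

Lemma continuous_funD f g : continuous f -> continuous g -> continuous (fun u => f u + g u).
Proof. by move=> cf cg u; apply: cvgD; [exact: cf|exact: cg]. Qed.

Lemma continuous_funM f g : continuous f -> continuous g -> continuous (fun u => f u * g u).
Proof. by move=> cf cg u; apply: cvgM; [exact: cf|exact: cg]. Qed.

Lemma continuous_funN f : continuous f -> continuous (fun u => - f u).
Proof. by move=> cf u; apply: cvgN; exact: cf. Qed.

Lemma continuous_fun_comp (h : R -> R) f :
  continuous h -> continuous f -> continuous (fun u => h (f u)).
Proof. by move=> ch cf u; apply: (continuous_comp (cf u) (ch _)). Qed.

Lemma continuous_proj : continuous (fun u : T => u.1.1) /\
  continuous (fun u : T => u.1.2) /\ continuous (fun u : T => u.2).
Proof.
split; last split; move=> u.
- exact: (@continuous_comp _ _ _ (@fst (R * R) R) fst u (cvg_fst) (cvg_fst)).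
- exact: (@continuous_comp _ _ _ (@fst (R * R) R) snd u (cvg_fst) (cvg_snd)).
- exact: cvg_snd.
Qed.

Lemma continuous_vec4 (a b c d : T -> R) :
  continuous a -> continuous b -> continuous c -> continuous d ->
  continuous (fun u => vec4 (a u) (b u) (c u) (d u)).
Proof.
move=> ca cb cc cd u; apply: continuous_mx => i j; rewrite (ord1 i).
have E1 (f : T -> R) : (forall v, vec4 (a v) (b v) (c v) (d v) 0 j = f v) ->
    continuous f -> {for u, continuous (fun v => vec4 (a v) (b v) (c v) (d v) 0 j : R^o)}.
  by move=> /funext -> cf; exact: cf.
by elim/ord4P: j E1 => E1; [apply: E1 ca|apply: E1 cb|apply: E1 cc|apply: E1 cd] => v;
  rewrite vec4E.
Qed.

Lemma continuous_trig : [/\ continuous (fun u : T => cos u.1.1),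
  continuous (fun u : T => sin u.1.1), continuous (fun u : T => cos u.1.2),
  continuous (fun u : T => sin u.1.2) & continuous (fun u : T => cos u.2)] /\
  continuous (fun u : T => sin u.2).
Proof.
have [cx [cy cz]] := continuous_proj.
by split; first split; apply: continuous_fun_comp => //;
  (exact: continuous_cos || exact: continuous_sin).
Qed.

Lemma continuous_hopf_chart : continuous (@hopf_chart R).
Proof.
have -> : @hopf_chart R = (fun u => vec4 (cos u.1.1 * cos u.1.2) (cos u.1.1 * sin u.1.2)
    (sin u.1.1 * cos u.2) (sin u.1.1 * sin u.2)).
  by apply/funext => -[[x y] z].
have [[cx sx cy sy cz] sz] := continuous_trig.
by apply: continuous_vec4; apply: continuous_funM.
Qed.

Lemma continuous_derive_hopf (phi : E -> R^o) (U : set E) (C : T -> E) :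
  smooth_on U phi -> @S3 R `<=` U -> continuous C ->
  continuous (fun u => 'D_(C u) phi (hopf_chart u)).
Proof.
move=> sphi SU cC.
rewrite (_ : (fun _ => _) = (fun u => \sum_k C u 0 k * 'D_(delta_mx 0 k) phi (hopf_chart u))).
  apply: (@continuous_big _ _ +%R 0 xpredT) => [|k _]; first exact: add_continuous.
  apply: continuous_funM => u.
    exact: (@continuous_comp _ _ _ C (fun M : E => M 0 k : R) u (cC u)
      (@coord_continuous R 1 4 0 k (C u))).
  exact: (@continuous_comp _ _ _ (@hopf_chart R) (fun p => 'D_(delta_mx 0 k) phi p) u
    (@continuous_hopf_chart u)
    (smooth_on_continuous (smooth_on_derive (delta_mx 0 k) sphi) (SU _ (S3_hopf u)))).
by apply/funext => u; rewrite (smooth_on_derive_sum _ sphi (SU _ (S3_hopf u))).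
Qed.

Lemma continuous_comp_hopf (phi : E -> R^o) (U : set E) :
  smooth_on U phi -> @S3 R `<=` U -> continuous (fun u => phi (hopf_chart u)).
Proof.
move=> sphi SU u; exact: (@continuous_comp _ _ _ (@hopf_chart R) phi u
  (@continuous_hopf_chart u) (smooth_on_continuous sphi (SU _ (S3_hopf u)))).
Qed.

Section Field.
Variables (a b K : R).

(** In the coordinates of a j p + b k p the two angles enter only through their sum, as [kappa] and
    [tau]; [kappa] is the derivative of [tau]. *)
Let kappa t : R := a * cos t + b * sin t.
Let tau t : R := a * sin t - b * cos t.

Let dtau z y : is_derive y 1 (fun t => tau (t + z)) (kappa (y + z)).
Proof.
have sh : is_derive y 1 (fun t => t + z) (1 + 0) by apply: is_deriveD.
have dc : is_derive y 1 (fun t => cos (t + z)) (- sin (y + z) * (1 + 0)).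
  exact: (@is_derive1_comp _ (@cos R) (fun t => t + z)).
have ds : is_derive y 1 (fun t => sin (t + z)) (cos (y + z) * (1 + 0)).
  exact: (@is_derive1_comp _ (@sin R) (fun t => t + z)).
apply: is_derive_eq (is_deriveB (is_derive_mull a ds) (is_derive_mull b dc)) _.
by rewrite /kappa; ring.
Qed.

Let A0 x t : R := K * (cos x * sin x) * kappa t.
Let A1 x t : R := K * sin x ^+ 2 * tau t.
Let A2 x t : R := - (K * cos x ^+ 2) * tau t.

(* The coordinates, weighted by the volume density, of a jmul + b kmul in the
   Hopf chart. *)
Let field_coord x y z : (K * (cos x * sin x)) *:
    (a *: jmul (hopf_chart (x, y, z)) + b *: kmul (hopf_chart (x, y, z))) =
  A0 x (y + z) *: hopf_eta x y z + A1 x (y + z) *: hopf_xi1 x y + A2 x (y + z) *: hopf_xi2 x z.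
Proof.
have hy := cos2Dsin2 y; have hz := cos2Dsin2 z.
rewrite /A0 /A1 /A2 /kappa /tau cosD sinD.
by apply: rV4_eq; rewrite !(vec4E, mxE) /=;
  [rewrite -[LHS]mulr1 -hy|rewrite -[LHS]mulr1 -hy|
   rewrite -[LHS]mulr1 -hz|rewrite -[LHS]mulr1 -hz]; ring.
Qed.

Variables (phi : E -> R^o) (U : set E).
Hypotheses (sphi : smooth_on U phi) (SU : @S3 R `<=` U).

Let dphi (w : E) u : R := 'D_w phi (hopf_chart u).

Let chain0 x y z : is_derive x 1 (fun t => phi (hopf_chart (t, y, z)))
  (dphi (hopf_eta x y z) (x, y, z)).
Proof. exact: (@smooth_on_chain _ _ U phi (fun t => hopf_chart (t, y, z)) x _ sphi
  (SU (S3_hopf (x, y, z))) (is_derive_hopf_eta x y z)). Qed.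

Let chain1 x y z : is_derive y 1 (fun t => phi (hopf_chart (x, t, z)))
  (dphi (hopf_xi1 x y) (x, y, z)).
Proof. exact: (@smooth_on_chain _ _ U phi (fun t => hopf_chart (x, t, z)) y _ sphi
  (SU (S3_hopf (x, y, z))) (is_derive_hopf_xi1 x y z)). Qed.

Let chain2 x y z : is_derive z 1 (fun t => phi (hopf_chart (x, y, t)))
  (dphi (hopf_xi2 x z) (x, y, z)).
Proof. exact: (@smooth_on_chain _ _ U phi (fun t => hopf_chart (x, y, t)) z _ sphi
  (SU (S3_hopf (x, y, z))) (is_derive_hopf_xi2 x y z)). Qed.

(** The three terms of the divergence of [phi] times the weighted field. The coefficients of [phi]
    add up to 0, because (cos^2 - sin^2) + sin^2 - cos^2 = 0: the field is divergence free. *)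
Let G0 u := A0 u.1.1 (u.1.2 + u.2) * dphi (hopf_eta u.1.1 u.1.2 u.2) u +
  phi (hopf_chart u) * (K * (cos u.1.1 ^+ 2 - sin u.1.1 ^+ 2) * kappa (u.1.2 + u.2)).
Let G1 u := A1 u.1.1 (u.1.2 + u.2) * dphi (hopf_xi1 u.1.1 u.1.2) u +
  phi (hopf_chart u) * (K * sin u.1.1 ^+ 2 * kappa (u.1.2 + u.2)).
Let G2 u := A2 u.1.1 (u.1.2 + u.2) * dphi (hopf_xi2 u.1.1 u.2) u +
  phi (hopf_chart u) * (- (K * cos u.1.1 ^+ 2) * kappa (u.1.2 + u.2)).

Let dG0 x y z : is_derive x 1 (fun t => A0 t (y + z) * phi (hopf_chart (t, y, z))) (G0 (x, y, z)).
Proof.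
have dcs : is_derive x 1 (fun t => cos t * sin t) (cos x * cos x + sin x * - sin x).
  by apply: is_deriveM.
have dA : is_derive x 1 (fun t => A0 t (y + z)) (K * (cos x ^+ 2 - sin x ^+ 2) * kappa (y + z)).
  apply: is_derive_eq (is_derive_mulr (kappa (y + z)) (is_derive_mull K dcs)) _.
  by ring.
exact: (is_deriveM dA (chain0 x y z)).
Qed.

Let dG1 x y z : is_derive y 1 (fun t => A1 x (t + z) * phi (hopf_chart (x, t, z))) (G1 (x, y, z)).
Proof. exact: (is_deriveM (is_derive_mull _ (dtau z y)) (chain1 x y z)). Qed.

Let dG2 x y z : is_derive z 1 (fun t => A2 x (y + t) * phi (hopf_chart (x, y, t))) (G2 (x, y, z)).
Proof.
have dt : is_derive z 1 (fun t => tau (y + t)) (kappa (y + z)).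
  rewrite addrC (_ : (fun _ => _) = (fun t => tau (t + y))); first exact: dtau.
  by apply/funext => t; rewrite addrC.
exact: (is_deriveM (is_derive_mull _ dt) (chain2 x y z)).
Qed.

Let cont_phase : continuous (fun u : T => kappa (u.1.2 + u.2)) /\
  continuous (fun u : T => tau (u.1.2 + u.2)).
Proof.
have [_ [cy cz]] := continuous_proj.
have cyz : continuous (fun u : T => u.1.2 + u.2) by exact: continuous_funD.
have cC : continuous (fun u : T => cos (u.1.2 + u.2)).
  by apply: continuous_fun_comp => //; exact: continuous_cos.
have cS : continuous (fun u : T => sin (u.1.2 + u.2)).
  by apply: continuous_fun_comp => //; exact: continuous_sin.
have ck (k : R) : continuous (fun u : T => k) by move=> u; exact: cvg_cst.
split; first by apply: continuous_funD; apply: continuous_funM.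
by apply: continuous_funD; [|apply: continuous_funN]; apply: continuous_funM.
Qed.

Let cont_G : [/\ continuous G0, continuous G1 & continuous G2].
Proof.
have [ckap ctau] := cont_phase.
have [[cx sx cy sy cz] sz] := continuous_trig.
have ck (k : R) : continuous (fun u : T => k) by move=> u; exact: cvg_cst.
have cphi := continuous_comp_hopf sphi SU.
have c0 : continuous (fun u : T => hopf_eta u.1.1 u.1.2 u.2).
  by apply: continuous_vec4; apply: continuous_funM => //; exact: continuous_funN.
have c1 : continuous (fun u : T => hopf_xi1 u.1.1 u.1.2).
  by apply: continuous_vec4 => //; apply: continuous_funM => //; exact: continuous_funN.
have c2 : continuous (fun u : T => hopf_xi2 u.1.1 u.2).
  by apply: continuous_vec4 => //; apply: continuous_funM => //; exact: continuous_funN.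
have cx2 : continuous (fun u : T => cos u.1.1 ^+ 2) by apply: continuous_funM.
have sx2 : continuous (fun u : T => sin u.1.1 ^+ 2) by apply: continuous_funM.
have Kcx2 : continuous (fun u : T => K * cos u.1.1 ^+ 2) by apply: continuous_funM.
have Ksx2 : continuous (fun u : T => K * sin u.1.1 ^+ 2) by apply: continuous_funM.
have Kcs : continuous (fun u : T => K * (cos u.1.1 * sin u.1.1)).
  by apply: continuous_funM => //; exact: continuous_funM.
have Kd : continuous (fun u : T => K * (cos u.1.1 ^+ 2 - sin u.1.1 ^+ 2)).
  by apply: continuous_funM => //; apply: continuous_funD => //; exact: continuous_funN.
have NK := continuous_funN Kcx2.
have d0 := continuous_derive_hopf sphi SU c0.
have d1 := continuous_derive_hopf sphi SU c1.
have d2 := continuous_derive_hopf sphi SU c2.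
split.
- exact: (continuous_funD (continuous_funM (continuous_funM Kcs ckap) d0)
    (continuous_funM cphi (continuous_funM Kd ckap))).
- exact: (continuous_funD (continuous_funM (continuous_funM Ksx2 ctau) d1)
    (continuous_funM cphi (continuous_funM Ksx2 ckap))).
- exact: (continuous_funD (continuous_funM (continuous_funM NK ctau) d2)
    (continuous_funM cphi (continuous_funM NK ckap))).
Qed.

Let slice0 g y z : continuous g -> continuous (fun x => g (x, y, z)).
Proof.
move=> cg x.
have cp : {for x, continuous (fun t : R => (t, y, z))}.
  exact: (cvg_pair (cvg_pair cvg_id (cvg_cst _)) (cvg_cst _)).
exact: (@continuous_comp _ _ _ (fun t => (t, y, z)) g x cp (@cg _)).
Qed.

Let slice1 g x z : continuous g -> continuous (fun y => g (x, y, z)).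
Proof.
move=> cg y.
have cp : {for y, continuous (fun t : R => (x, t, z))}.
  exact: (cvg_pair (cvg_pair (cvg_cst _) cvg_id) (cvg_cst _)).
exact: (@continuous_comp _ _ _ (fun t => (x, t, z)) g y cp (@cg _)).
Qed.

Let slice2 g x y : continuous g -> continuous (fun z => g (x, y, z)).
Proof.
move=> cg z.
have cp : {for z, continuous (fun t : R => (x, y, t))}.
  exact: (cvg_pair (cvg_cst _) cvg_id).
exact: (@continuous_comp _ _ _ (fun t => (x, y, t)) g z cp (@cg _)).
Qed.

Let pi2 : (0 : R) < pi / 2. Proof. by rewrite divr_gt0 // pi_gt0. Qed.
Let pipi : (0 : R) < 2 * pi. Proof. by rewrite mulr_gt0 // pi_gt0. Qed.

Let cos2 t : cos (t + 2 * pi) = cos t :> R.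
Proof. by rewrite mulr_natl cosD2pi. Qed.
Let sin2 t : sin (t + 2 * pi) = sin t :> R.
Proof. by rewrite mulr_natl sinD2pi. Qed.

(** Boundary terms vanish in each variable: along eta they carry the factor cos eta sin eta, zero at
    both ends where the coordinate tori collapse to circles, and along the two angles they cancel by
    periodicity. *)
Lemma integral_field_eq0 :
  \int[mu3]_(u in hopf_chart_dom (R := R))
   ('D_((K * (cos u.1.1 * sin u.1.1)) *:
     (a *: jmul (hopf_chart u) + b *: kmul (hopf_chart u))) phi (hopf_chart u)) = 0.
Proof.
have [c0 c1 c2] := cont_G.
have -> : \int[mu3]_(u in hopf_chart_dom (R := R))
   ('D_((K * (cos u.1.1 * sin u.1.1)) *:
     (a *: jmul (hopf_chart u) + b *: kmul (hopf_chart u))) phi (hopf_chart u)) =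
   \int[mu3]_(u in hopf_chart_dom (R := R)) (G0 u + G1 u + G2 u).
  apply: eq_Rintegral => -[[x y] z] _; rewrite field_coord.
  have df := smooth_on_differentiable sphi (SU (S3_hopf (x, y, z))).
  rewrite /G0 /G1 /G2 /dphi !deriveE //= !linearD !linearZ /=.
  by rewrite /A0 /A1 /A2 /GRing.scale /=; ring.
have cI := continuous_box_integrable pi2 pipi pipi.
have i0 := cI _ c0; have i1 := cI _ c1; have i2 := cI _ c2.
have i01 := cI _ (continuous_funD c0 c1).
have mb : measurable (hopf_chart_dom (R := R) :
    set (measurableTypeR R * measurableTypeR R * measurableTypeR R)%type).
  exact: measurable_box.
rewrite (RintegralD mb i01 i2) (RintegralD mb i0 i1).
have -> : \int[mu3]_(u in hopf_chart_dom (R := R)) G0 u = 0.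
  apply: (integral_box_eq0_fst pi2 pipi pipi c0) => y z.
  apply: (@integral_derive_eq0 R _ _ _ _ pi2 (@slice0 _ y z c0) (fun x => @dG0 x y z)).
  by rewrite /A0 sin0 cos_pihalf !(mul0r, mulr0).
have -> : \int[mu3]_(u in hopf_chart_dom (R := R)) G1 u = 0.
  apply: (integral_box_eq0_snd pi2 pipi pipi c1) => x z.
  apply: (@integral_derive_eq0 R _ _ _ _ pipi (@slice1 _ x z c1) (fun y => @dG1 x y z)).
  have tp t : tau (t + 2 * pi) = tau t by rewrite /tau cos2 sin2.
  rewrite /A1 [2 * pi + z]addrC tp add0r; congr (_ * _); congr phi.
  by rewrite /= -[2 * pi]add0r cos2 sin2.
have -> : \int[mu3]_(u in hopf_chart_dom (R := R)) G2 u = 0.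
  apply: (integral_box_eq0_thd pi2 pipi pipi c2) => x y.
  apply: (@integral_derive_eq0 R _ _ _ _ pipi (@slice2 _ x y c2) (fun z => @dG2 x y z)).
  have tp t : tau (t + 2 * pi) = tau t by rewrite /tau cos2 sin2.
  rewrite /A2 tp addr0; congr (_ * _); congr phi.
  by rewrite /= -[2 * pi]add0r cos2 sin2.
by rewrite !addr0.
Qed.

End Field.
End Divergence.

(** * The second variation of the energy *)

Section Slices.
Context {R : realType} {V1 V2 : normedModType R} {W : normedModType R}.
Implicit Types (f : V1 * V2 -> W) (U : set (V1 * V2)).

Lemma is_derive_slicer f t q w (d : W) :
  is_derive (t, q) (0, w) f d -> is_derive q w (fun r => f (t, r)) d.
Proof.
move=> fd.
have h : is_derive (0 *: (0, w) + (t, q)) (0, w) f d by rewrite scale0r add0r.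
have := (is_derive_line f (t, q) (0, w) d 0).1 h.
rewrite (_ : (fun _ => _) = fun s : R => (fun r => f (t, r)) (s *: w + q)); last first.
  apply/funext => s; congr f.
  rewrite (_ : s *: (0, w) + (t, q) = (s *: 0 + t, s *: w + q) :> V1 * V2) //.
  by rewrite scaler0 add0r.
by move/(is_derive_line (fun r => f (t, r)) q w d 0).2; rewrite scale0r add0r.
Qed.

Lemma smooth_on_slicer U f t : smooth_on U f ->
  smooth_on [set q | U (t, q)] (fun q => f (t, q)).
Proof.
move=> sf; have pc : continuous (fun q : V2 => (t, q)) by exact: continuous_pairr.
apply: (@smooth_on_coind _ _ _ _
  (fun g => exists2 h : V1 * V2 -> W, smooth_on U h & g = fun q => h (t, q))).
- rewrite (_ : [set q | U (t, q)] = (fun q => (t, q)) @^-1` U) //.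
  by apply: open_comp; [move=> q _; exact: pc|exact: smooth_on_open sf].
- move=> _ q [h sh ->] Uq.
  exact: (@continuous_comp _ _ _ (fun q => (t, q)) h q (pc q) (smooth_on_continuous sh Uq)).
- move=> _ w [h sh ->]; exists (fun q => 'D_(0, w) h (t, q)).
    by exists ('D_(0, w) h); [exact: smooth_on_derive|].
  by move=> q Uq; apply: is_derive_slicer; exact: smooth_on_is_derive sh Uq.
- by exists f.
Qed.

Lemma derive_slicer U f t q w : smooth_on U f -> U (t, q) ->
  'D_w (fun r => f (t, r)) q = 'D_(0, w) f (t, q).
Proof.
move=> sf Uq.
by have [_ ->] := is_derive_slicer (smooth_on_is_derive (0, w) sf Uq).
Qed.

End Slices.

Section TimeSlices.
Context {R : realType} {V W : normedModType R}.

Lemma is_derive_slicel (f : R^o * V -> W) (t : R) q (d : W) :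
  is_derive ((t : R^o), q) (1, 0) f d -> is_derive t 1 (fun s : R => f (s, q)) d.
Proof.
move=> fd.
have E1 (s : R) : s *: ((1, 0) : R^o * V) + (0, q) = (s, q).
  rewrite (_ : s *: (1, 0) + (0, q) = (s *: (1 : R^o) + 0, s *: 0 + q) :> R^o * V) //.
  by rewrite scaler0 add0r addr0 [_ *: _]mulr1.
rewrite -E1 in fd; have := (is_derive_line f (0, q) (1, 0) d t).1 fd.
by congr (is_derive _ _ _ _); apply/funext => s; rewrite E1.
Qed.

End TimeSlices.

Section Sphere.
Context {R : realType}.
Local Notation E := 'rV[R]_4.

(* The derivative along the frame is taken along great circles of S^3. *)
Lemma derive_frame_tangent (U : set E) (f g : E -> R^o) i p :
  smooth_on U f -> smooth_on U g -> @S3 R `<=` U -> (forall q, S3 q -> f q = g q) ->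
  S3 p -> 'D_(frame i p) f p = 'D_(frame i p) g p.
Proof.
move=> sf sg SU fg p1.
pose c (t : R) : E := vec4 (cos t * p 0 0 + sin t * frame i p 0 0)
  (cos t * p 0 1 + sin t * frame i p 0 1) (cos t * p 0 2 + sin t * frame i p 0 2)
  (cos t * p 0 3 + sin t * frame i p 0 3).
have cE t : c t = cos t *: p + sin t *: frame i p.
  by apply: rV4_eq; rewrite vec4E !mxE.
have cS t : S3 (c t).
  rewrite /S3 /= cE; have := cos2Dsin2 t; have := dot_frame_self i p.
  have := dot_frame i i p; rewrite p1 eqxx mulr1 => ee ep cs.
  rewrite [LHS](_ : _ = cos t ^+ 2 * dot p p + 2 * (cos t * sin t) * dot (frame i p) p
    + sin t ^+ 2 * dot (frame i p) (frame i p)); last by rewrite !dotE !mxE; ring.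
  by rewrite p1 ee ep !mulr1 mulr0 addr0.
have c0 : c 0 = p by rewrite cE cos0 sin0 scale1r scale0r addr0.
have dc : is_derive (0 : R) 1 c (frame i p).
  have d k : is_derive (0 : R) 1 (fun t : R => cos t * p 0 k + sin t * frame i p 0 k)
      (frame i p 0 k).
    have d1 : is_derive (0 : R) 1 (fun t : R => cos t * p 0 k) (- sin 0 * p 0 k).
      by apply: is_derive_mulr.
    have d2 : is_derive (0 : R) 1 (fun t : R => sin t * frame i p 0 k) (cos 0 * frame i p 0 k).
      by apply: is_derive_mulr.
    by apply: is_derive_eq (is_deriveD d1 d2) _; rewrite sin0 cos0 oppr0 mul0r add0r mul1r.
  have -> : frame i p = vec4 (frame i p 0 0) (frame i p 0 1) (frame i p 0 2) (frame i p 0 3).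
    by apply: rV4_eq; rewrite vec4E.
  apply: is_derive_eq (is_derive_vec4 (d 0) (d 1) (d 2) (d 3)) _.
  by apply: rV4_eq; rewrite !vec4E.
have dcp (h : E -> R^o) : smooth_on U h -> is_derive (0 : R) 1 (fun t => h (c t)) ('D_(frame i p) h p).
  move=> sh; have Uc : U (c 0) by apply: SU; exact: cS.
  by have := smooth_on_chain sh Uc dc; rewrite c0.
have df := dcp f sf; have [_ <-] := dcp g sg.
rewrite (_ : (fun t => g (c t)) = (fun t => f (c t))); first by have [_ ->] := df.
by apply/funext => t; exact/esym/fg.
Qed.

End Sphere.

(** * Second derivatives of sums of squares *)

Section SecondOrder.
Context {R : realType} {V : normedModType R}.
Variables (U : set V) (x v : V).
Hypothesis Ux : U x.
Implicit Types f g z : V -> R^o.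

(** Criticality at [x] along [v] together with the value of the second derivative; packed with
    smoothness so that it adds up term by term. *)
Definition second_order f (h : R) :=
  [/\ smooth_on U f, 'D_v f x = 0 & 'D_v (fun y => 'D_v f y) x = h].

Lemma second_order_cst (c : R) : open U -> second_order (fun=> c) 0.
Proof.
move=> oU; have D0 (k : R) : (fun y : V => 'D_v (fun=> k : R^o) y) = fun=> 0.
  by apply/funext => y; exact: derive_cst.
split; [exact: smooth_on_cst|exact: derive_cst|].
by rewrite D0; exact: derive_cst.
Qed.

Lemma second_orderD f g (h k : R) :
  second_order f h -> second_order g k -> second_order (fun y => f y + g y) (h + k).
Proof.
move=> [sf f1 f2] [sg g1 g2]; have oU := smooth_on_open sf.
have D1 y : U y -> 'D_v (fun r => f r + g r : R^o) y = 'D_v f y + 'D_v g y.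
  move=> Uy; have [_ <-] := is_deriveD (smooth_on_is_derive v sf Uy)
    (smooth_on_is_derive v sg Uy).
  by [].
split; [exact: (smooth_onD sf sg)|by rewrite D1 // f1 g1 addr0|].
rewrite (smooth_on_near_derive v oU Ux D1) -f2 -g2.
have [_ <-] := is_deriveD (smooth_on_is_derive v (smooth_on_derive v sf) Ux)
  (smooth_on_is_derive v (smooth_on_derive v sg) Ux).
by [].
Qed.

(** In (z^2)'' = 2 z'^2 + 2 z z'' the last term vanishes with [z], so only the first derivative of
    [z] remains. This makes the Hessian depend on the velocity alone. *)
Lemma second_order_sqr z (c : R) : smooth_on U z -> z x = 0 ->
  second_order (fun y => c * (z y * z y)) (2 * c * 'D_v z x ^+ 2).
Proof.
move=> sz z0; have oU := smooth_on_open sz.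
have sc := smooth_on_cst (c : R^o) oU.
have dsq y : U y -> is_derive y v (fun y => c * (z y * z y) : R^o)
    (2 * c * (z y * 'D_v z y)).
  move=> Uy; have dz := smooth_on_is_derive v sz Uy.
  apply: is_derive_eq (is_deriveM (is_derive_cst (c : R^o) y v) (is_deriveM dz dz)) _.
  by rewrite /GRing.scale /=; ring.
have D1 y : U y -> 'D_v (fun y => c * (z y * z y) : R^o) y = 2 * c * (z y * 'D_v z y).
  by move=> Uy; have [_ ->] := dsq y Uy.
split.
- exact: (smooth_onM sc (smooth_onM sz sz)).
- by rewrite D1 // z0 mul0r mulr0.
- rewrite (smooth_on_near_derive v oU Ux D1).
  have dz := smooth_on_is_derive v sz Ux.
  have ddz := smooth_on_is_derive v (smooth_on_derive v sz) Ux.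
  have [_ ->] := is_deriveM (is_derive_cst (2 * c : R^o) x v) (is_deriveM dz ddz).
  by rewrite /GRing.scale /= z0; ring.
Qed.

End SecondOrder.

Section Variation.
Context {R : realType}.
Local Notation E := 'rV[R]_4.
Local Notation V := (R^o * E)%type.
Local Notation mu3 := (@lebesgue_measure R \x @lebesgue_measure R \x @lebesgue_measure R)%E.
Local Notation dom := (@hopf_chart_dom R).
Variables (W : set V) (e : R).
Hypotheses (e0 : 0 < e) (oW : open W).
Hypothesis WS : forall (t : R) p, `|t| < e -> S3 p -> W ((t : R^o), p).
Implicit Types (p q : E) (t : R).

Let tau : V := (1, 0).

Let pi2 : (0 : R) < pi / 2. Proof. by rewrite divr_gt0 // pi_gt0. Qed.
Let pipi : (0 : R) < 2 * pi. Proof. by rewrite mulr_gt0 // pi_gt0. Qed.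

(** With [K] the square root of lambda this is the volume density of g_lambda in the chart; other
    values of [K] absorb scalar factors of an integrand. *)
Definition weight (K : R) (u : R * R * R) : R := K * (cos u.1.1 * sin u.1.1).

Lemma continuous_weight K : continuous (weight K).
Proof.
have [[cx sx _ _ _] _] := @continuous_trig R.
by apply: continuous_funM; [move=> u; exact: cvg_cst|exact: continuous_funM].
Qed.

Lemma continuous_slice_hopf (g : V -> R^o) t : smooth_on W g -> `|t| < e ->
  continuous (fun u => g ((t : R^o), hopf_chart u)).
Proof.
move=> sg te.
apply: (continuous_comp_hopf (smooth_on_slicer (t : R^o) sg)).
by move=> p p1; exact: WS.
Qed.

Definition weighted_integral K (g : V -> R^o) t : R :=
  \int[mu3]_(u in dom) (g ((t : R^o), hopf_chart u) * weight K u).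

Lemma continuous_integrand K (g : V -> R^o) t : smooth_on W g -> `|t| < e ->
  continuous (fun u => g ((t : R^o), hopf_chart u) * weight K u).
Proof.
move=> sg te.
exact: (continuous_funM (continuous_slice_hopf sg te) (@continuous_weight K)).
Qed.

(** Halving [e] leaves a compact set of times. On its product with the closed box the time
    derivative is continuous, hence bounded, and one may differentiate under the integral. *)
Lemma is_derive_weighted_integral K (g : V -> R^o) t : smooth_on W g -> `|t| < e / 2 ->
  is_derive t 1 (weighted_integral K g) (weighted_integral K (fun x => 'D_tau g x) t).
Proof.
move=> sg te2; have sdg := smooth_on_derive tau sg.
have e2e : e / 2 < e by rewrite ltr_pdivrMr // ltr_pMr // ltr1n.
pose box := (`[0, pi / 2] `*` `[0, 2 * pi] `*` `[0, 2 * pi])%classic : set (R * R * R).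
pose B := (`[- (e / 2), e / 2] `*` box)%classic : set (R * (R * R * R)).
pose F (x : R * (R * R * R)) : R := 'D_tau g ((x.1 : R^o), hopf_chart x.2) * weight K x.2.
have cB : compact B.
  by apply: compact_setX; [exact: segment_compact|exact: compact_cbox].
have cF : {in B, continuous F}.
  move=> -[s u]; rewrite inE => -[/= sI uI].
  have se : `|s| < e by rewrite (le_lt_trans _ e2e) // ler_norml; move: sI; rewrite in_itv.
  have cp : {for (s, u), continuous (fun x : R * (R * R * R) => ((x.1 : R^o), hopf_chart x.2) : V)}.
    apply: (cvg_pair (G := nbhs (s : R^o)) (H := nbhs (hopf_chart u))).
      exact: cvg_fst.
    exact: (@continuous_comp _ _ _ snd (@hopf_chart R) (s, u) cvg_snd (@continuous_hopf_chart R u)).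
  apply: cvgM.
    exact: (@continuous_comp _ _ _ (fun x : R * (R * R * R) => ((x.1 : R^o), hopf_chart x.2) : V)
     ('D_tau g) (s, u) cp (smooth_on_continuous sdg (WS se (S3_hopf u)))).
  exact: (@continuous_comp _ _ _ snd (weight K) (s, u) cvg_snd (@continuous_weight K u)).
have [M hM] := compact_bound cB cF.
apply: (is_derive_integral_box pi2 pipi pipi (e := e / 2) (M := M)
  (f := fun t u => g ((t : R^o), hopf_chart u) * weight K u)
  (df := fun t u => 'D_tau g ((t : R^o), hopf_chart u) * weight K u)) => //.
- by move=> s se; apply: continuous_integrand => //; exact: lt_trans e2e.
- move=> s u se _; apply: is_derive_mulr; apply: is_derive_slicel.
  by apply: smooth_on_is_derive sg _; apply: WS; [exact: lt_trans e2e|exact: S3_hopf].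
- move=> s u se du; apply: (hM (s, u)); split; last exact: sub_cbox.
  by rewrite /= in_itv /= -ler_norml ltW.
Qed.

End Variation.

(** * The energy along a variation of the Hopf field *)

Section Energy.
Context {R : realType}.
Local Notation E := 'rV[R]_4.
Local Notation V := (R^o * E)%type.
Local Notation mu3 := (@lebesgue_measure R \x @lebesgue_measure R \x @lebesgue_measure R)%E.
Local Notation dom := (@hopf_chart_dom R).

Lemma smooth_on_time (W : set V) : open W -> smooth_on W (fun x : V => x.1).
Proof. by move=> oW; apply: (smooth_on_linear (l := fst)) => // x; exact: cvg_fst. Qed.

Lemma smooth_on_point (W : set V) : open W -> smooth_on W (fun x : V => x.2).
Proof. by move=> oW; apply: (smooth_on_linear (l := snd)) => // x; exact: cvg_snd. Qed.

Section Components.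
Variables (W : set V) (e : R) (X : R -> E -> E).
Hypothesis WS : forall (t : R) p, `|t| < e -> S3 p -> W ((t : R^o), p).
Hypothesis sX : smooth_on W (fun x : V => X x.1 x.2).
Implicit Types (p q : E) (t : R).

Let oW : open W := smooth_on_open sX.

Definition vcoef j (x : V) : R^o := dot (X x.1 x.2) (frame j x.2).

(** The derivative of the [j]-th component along the [i]-th frame field. Since the direction varies
    with the point, it is written as a sum over fixed directions, which makes it visibly smooth in
    time and point. *)
Definition dcoef i j (x : V) : R^o :=
  \sum_k frame i x.2 0 k * 'D_(0, delta_mx 0 k) (vcoef j) x.

Lemma smooth_vcoef j : smooth_on W (vcoef j).
Proof. exact: (smooth_on_dot sX (smooth_on_frame_comp j (smooth_on_point oW))). Qed.

Lemma smooth_dcoef i j : smooth_on W (dcoef i j).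
Proof.
apply: smooth_on_sum => // k.
exact: (smooth_onM (smooth_on_coord 0 k (smooth_on_frame_comp i (smooth_on_point oW)))
  (smooth_on_derive (0, delta_mx 0 k) (smooth_vcoef j))).
Qed.

Lemma dcoef_slice i j t p : W ((t : R^o), p) ->
  dcoef i j ((t : R^o), p) = 'D_(frame i p) (fun q => vcoef j ((t : R^o), q)) p.
Proof.
move=> Wp.
rewrite (smooth_on_derive_sum _ (smooth_on_slicer (t : R^o) (smooth_vcoef j)) Wp).
by apply: eq_bigr => k _; rewrite (derive_slicer _ (smooth_vcoef j) Wp).
Qed.

Lemma dcoefE i j t p : W ((t : R^o), p) ->
  dcoef i j ((t : R^o), p) = 'D_(0, frame i p) (vcoef j) ((t : R^o), p).
Proof. by move=> Wp; rewrite dcoef_slice // (derive_slicer _ (smooth_vcoef j) Wp). Qed.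

Lemma integral_dcoef_eq0 i j K t : `|t| < e -> i != 0 ->
  weighted_integral K (dcoef i j) t = 0.
Proof.
move=> te i0; rewrite /weighted_integral.
have sphi := smooth_on_slicer (t : R^o) (smooth_vcoef j).
have SU : @S3 R `<=` [set q | W ((t : R^o), q)] by move=> q; exact: WS.
rewrite -(integral_field_eq0 (i == 1)%:R (i == 2)%:R K sphi SU).
apply: eq_Rintegral => u _; rewrite dcoef_slice; last by apply: WS => //; exact: S3_hopf.
have df := smooth_on_differentiable sphi (SU _ (S3_hopf u)).
have -> : (i == 1)%:R *: jmul (hopf_chart u) + (i == 2)%:R *: kmul (hopf_chart u) =
    frame i (hopf_chart u).
  by elim/ord3P: i i0 => // _; rewrite frameE /= ?scale1r ?scale0r ?addr0 ?add0r.
by rewrite !deriveE // linearZ /= mulrC.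
Qed.

End Components.

Section Trace.
Variables (mu lambda : R) (nabla : (E -> E) -> (E -> E) -> E -> E).
Hypotheses (mu0 : 0 < mu) (lambda0 : 0 < lambda) (hnabla : levi_civita mu nabla).
Variables (W : set V) (e : R) (X : R -> E -> E).
Hypothesis WS : forall (t : R) p, `|t| < e -> S3 p -> W ((t : R^o), p).
Hypothesis sX : smooth_on W (fun x : V => X x.1 x.2).
Hypothesis uX : forall t : R, `|t| < e -> unit_field mu (X t).
Implicit Types (p q : E) (t : R) (x : V).

Let oW : open W := smooth_on_open sX.
Let s := Num.sqrt mu.
Let s0 : 0 < s. Proof. by rewrite sqrtr_gt0. Qed.
Let smu : mu = s ^+ 2. Proof. by rewrite sqr_sqrtr // ltW. Qed.

Let c j x := vcoef X j x.
Let d i j x := dcoef X i j x.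

(* Up to terms whose integral vanishes, the trace of L is a combination of
   squares of functions that vanish at the Hopf field: the linear terms are
   removed with the unit length condition and the divergence theorem. *)
Definition trace_quadratic x : R^o :=
  mu / lambda + 2 + 2 * mu + (
  mu / lambda * (d 0 0 x * d 0 0 x) + (
  lambda^-1 * ((d 0 1 x - (mu - 2) * c 2 x) * (d 0 1 x - (mu - 2) * c 2 x)) + (
  lambda^-1 * ((d 0 2 x + (mu - 2) * c 1 x) * (d 0 2 x + (mu - 2) * c 1 x)) + (
  mu * ((d 1 0 x - c 2 x) * (d 1 0 x - c 2 x)) + (
  1 * (d 1 1 x * d 1 1 x) + (
  1 * ((d 1 2 x + mu * c 0 x - s) * (d 1 2 x + mu * c 0 x - s)) + (
  mu * ((d 2 0 x + c 1 x) * (d 2 0 x + c 1 x)) + (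
  1 * ((d 2 1 x - mu * c 0 x + s) * (d 2 1 x - mu * c 0 x + s)) + (
  1 * (d 2 2 x * d 2 2 x) + (
  - 2 * mu * (c 1 x * c 1 x) + (
  - 2 * mu * (c 2 x * c 2 x) +
  - 2 * mu ^+ 2 * ((c 0 x - s^-1) * (c 0 x - s^-1))))))))))))).

Lemma trace_L_quadratic t p : `|t| < e -> S3 p ->
  \tr (L_matrix mu lambda nabla (X t) p) =
  trace_quadratic ((t : R^o), p) +
  2 * s * (d 1 2 ((t : R^o), p) - d 2 1 ((t : R^o), p)).
Proof.
move=> te p1; have [vX uXt] := uX te; have Wp := WS te p1.
have dE i j : 'D_(frame i p) (fun q => dot (X t q) (frame j q) : R^o) p =
    d i j ((t : R^o), p) by rewrite /d (dcoef_slice sX i j Wp).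
have cE j : dot (X t p) (frame j p) = c j ((t : R^o), p) by [].
rewrite (trace_L mu0 hnabla lambda0 vX p1) !sum3 !(nabla_coef hnabla _ _ vX p1) !sum3 !dE !cE.
have := uXt p p1; rewrite berger_tangent //; last exact: vX.2.
rewrite sum3 !cE /frame_weight /eps3 !ord3_val /=.
rewrite /trace_quadratic.
move: (c 0 _) (c 1 _) (c 2 _) => c0 c1 c2.
move: (d 0 0 _) (d 0 1 _) (d 0 2 _) (d 1 0 _) (d 1 1 _) (d 1 2 _) (d 2 0 _) (d 2 1 _) (d 2 2 _).
move=> d00 d01 d02 d10 d11 d12 d20 d21 d22 h.
have sN : s != 0 by rewrite gt_eqF.
have lN : lambda != 0 by rewrite gt_eqF.
rewrite smu in h *.
have {}h : s ^+ 2 * (c0 * c0) = 1 - (c1 * c1 + c2 * c2) by rewrite -h; ring.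
apply/eqP; rewrite -subr_eq0; apply/eqP.
(* The two sides differ by 2 mu times g_mu(X, X) - 1. The squares containing [- s] and [+ s] produce
   the cross terms in [d12] and [d21], which the linear term of the statement compensates. *)
transitivity (2 * s ^+ 2 * (s ^+ 2 * (c0 * c0) - (1 - (c1 * c1 + c2 * c2)))).
  by field; rewrite sN lN.
by rewrite h subrr mulr0.
Qed.

Section Hopf.
Hypothesis e0 : 0 < e.
Hypothesis X0 : forall p, S3 p -> X 0 p = hopf_field mu p.
Let tau : V := (1, 0).
Local Notation J := (weighted_integral (Num.sqrt lambda)).

Let W0 p : S3 p -> W ((0 : R^o), p).
Proof. by move=> p1; apply: WS => //; rewrite normr0. Qed.

Lemma vcoef_hopf j p : S3 p -> c j ((0 : R^o), p) = (j == 0)%:R * s^-1.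
Proof.
move=> p1; rewrite /c /vcoef /= X0 // /hopf_field dotZl (dot_frame 0 j) p1 mulr1 eq_sym.
by rewrite mulrC.
Qed.

(** The components of [X 0] are constant on S^3 only, nothing being known of [X 0] elsewhere. The
    frame directions are tangent, so [derive_frame_tangent] allows the comparison with a constant
    function. *)
Lemma dcoef_hopf i j p : S3 p -> d i j ((0 : R^o), p) = 0.
Proof.
move=> p1; rewrite /d (dcoef_slice sX i j (W0 p1)).
have sf := smooth_on_slicer (0 : R^o) (smooth_vcoef sX j).
have SU : @S3 R `<=` [set q | W ((0 : R^o), q)] by move=> q; exact: W0.
rewrite (derive_frame_tangent i sf (smooth_on_cst ((j == 0)%:R * s^-1 : R^o)
  (smooth_on_open sf)) SU _ p1); first exact: derive_cst.
by move=> q q1; rewrite -(vcoef_hopf j q1).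
Qed.

(** The second time derivative of [trace_quadratic] at the Hopf field, term by term. The initial 0
    comes from the constant term, and the factors are left unsimplified to match [second_orderD] and
    [second_order_sqr]. *)
Definition trace_hessian x : R :=
  0 + (
  2 * (mu / lambda) * 'D_tau (d 0 0) x ^+ 2 + (
  2 * lambda^-1 * 'D_tau (fun y => d 0 1 y - (mu - 2) * c 2 y : R^o) x ^+ 2 + (
  2 * lambda^-1 * 'D_tau (fun y => d 0 2 y + (mu - 2) * c 1 y : R^o) x ^+ 2 + (
  2 * mu * 'D_tau (fun y => d 1 0 y - c 2 y : R^o) x ^+ 2 + (
  2 * 1 * 'D_tau (d 1 1) x ^+ 2 + (
  2 * 1 * 'D_tau (fun y => d 1 2 y + mu * c 0 y - s : R^o) x ^+ 2 + (
  2 * mu * 'D_tau (fun y => d 2 0 y + c 1 y : R^o) x ^+ 2 + (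
  2 * 1 * 'D_tau (fun y => d 2 1 y - mu * c 0 y + s : R^o) x ^+ 2 + (
  2 * 1 * 'D_tau (d 2 2) x ^+ 2 + (
  2 * (- 2 * mu) * 'D_tau (c 1) x ^+ 2 + (
  2 * (- 2 * mu) * 'D_tau (c 2) x ^+ 2 +
  2 * (- 2 * mu ^+ 2) * 'D_tau (fun y => c 0 y - s^-1 : R^o) x ^+ 2))))))))))).

Lemma second_order_trace p : S3 p ->
  second_order W ((0 : R^o), p) tau trace_quadratic (trace_hessian ((0 : R^o), p)).
Proof.
move=> p1; have Wp := W0 p1.
have sc j : smooth_on W (c j) := smooth_vcoef sX j.
have sd i j : smooth_on W (d i j) := smooth_dcoef sX i j.
have sk (k : R) : smooth_on W (fun=> k : R^o) := smooth_on_cst (k : R^o) oW.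
have sN : s != 0 by rewrite gt_eqF.
have mus : mu * s^-1 = s by rewrite smu expr2 mulfK.
rewrite /trace_hessian; apply: (second_orderD Wp); first exact: second_order_cst.
apply: (second_orderD Wp).
  by apply: (second_order_sqr tau Wp _ (sd 0 0)); exact: dcoef_hopf.
apply: (second_orderD Wp).
  apply: (second_order_sqr tau Wp _ (smooth_onB (sd 0 1) (smooth_onM (sk (mu - 2)) (sc 2)))).
  by rewrite dcoef_hopf // vcoef_hopf // mul0r mulr0 subr0.
apply: (second_orderD Wp).
  apply: (second_order_sqr tau Wp _ (smooth_onD (sd 0 2) (smooth_onM (sk (mu - 2)) (sc 1)))).
  by rewrite dcoef_hopf // vcoef_hopf // mul0r mulr0 addr0.
apply: (second_orderD Wp).
  apply: (second_order_sqr tau Wp _ (smooth_onB (sd 1 0) (sc 2))).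
  by rewrite dcoef_hopf // vcoef_hopf // mul0r subr0.
apply: (second_orderD Wp).
  by apply: (second_order_sqr tau Wp _ (sd 1 1)); exact: dcoef_hopf.
apply: (second_orderD Wp).
  apply: (second_order_sqr tau Wp _ (smooth_onB (smooth_onD (sd 1 2)
    (smooth_onM (sk mu) (sc 0))) (sk s))).
  by rewrite dcoef_hopf // vcoef_hopf // eqxx mul1r add0r mus subrr.
apply: (second_orderD Wp).
  apply: (second_order_sqr tau Wp _ (smooth_onD (sd 2 0) (sc 1))).
  by rewrite dcoef_hopf // vcoef_hopf // mul0r addr0.
apply: (second_orderD Wp).
  apply: (second_order_sqr tau Wp _ (smooth_onD (smooth_onB (sd 2 1)
    (smooth_onM (sk mu) (sc 0))) (sk s))).
  by rewrite dcoef_hopf // vcoef_hopf // eqxx mul1r sub0r mus addNr.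
apply: (second_orderD Wp).
  by apply: (second_order_sqr tau Wp _ (sd 2 2)); exact: dcoef_hopf.
apply: (second_orderD Wp).
  apply: (second_order_sqr tau Wp _ (sc 1)).
  by rewrite vcoef_hopf // mul0r.
apply: (second_orderD Wp).
  apply: (second_order_sqr tau Wp _ (sc 2)).
  by rewrite vcoef_hopf // mul0r.
apply: (second_order_sqr tau Wp _ (smooth_onB (sc 0) (sk s^-1))).
by rewrite vcoef_hopf // eqxx mul1r subrr.
Qed.

Lemma smooth_trace_quadratic : smooth_on W trace_quadratic.
(* Any point of S^3 would do here. *)
Proof. by have [] := second_order_trace (S3_hopf (0, 0, 0)). Qed.

Lemma energy_quadratic t : `|t| < e ->
  energy mu lambda nabla (X t) = 2^-1 * J trace_quadratic t.
Proof.
move=> te; rewrite /energy; congr (_ * _).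
pose l := Num.sqrt lambda.
have sd i j : smooth_on W (d i j) := smooth_dcoef sX i j.
have pi2 : (0 : R) < pi / 2 by rewrite divr_gt0 // pi_gt0.
have pipi : (0 : R) < 2 * pi by rewrite mulr_gt0 // pi_gt0.
have cI := continuous_box_integrable pi2 pipi pipi.
have cg (g : V -> R^o) (K : R) : smooth_on W g ->
    continuous (fun u => g ((t : R^o), hopf_chart u) * weight K u).
  by move=> sg; exact: (continuous_integrand WS sg te).
have c1 := cg _ l smooth_trace_quadratic.
have c2 := cg _ (2 * s * l) (sd 1 2).
have c3 := cg _ (- (2 * s * l)) (sd 2 1).
have mb : measurable (hopf_chart_dom (R := R) :
    set (measurableTypeR R * measurableTypeR R * measurableTypeR R)%type).
  exact: measurable_box.
transitivity (\int[mu3]_(u in dom) (trace_quadratic ((t : R^o), hopf_chart u) * weight l u +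
    (d 1 2 ((t : R^o), hopf_chart u) * weight (2 * s * l) u +
     d 2 1 ((t : R^o), hopf_chart u) * weight (- (2 * s * l)) u))).
  rewrite /integral_S3; apply: eq_Rintegral => u; rewrite inE => du.
  rewrite volume_densityE // trace_L_quadratic //; last exact: S3_hopf.
  by rewrite /weight -/l; ring.
rewrite (RintegralD mb (cI _ c1) (cI _ (continuous_funD c2 c3))).
rewrite (RintegralD mb (cI _ c2) (cI _ c3)).
have /= := @integral_dcoef_eq0 W e X WS sX 1 2 (2 * s * l) t te isT.
rewrite /weighted_integral => ->.
have /= := @integral_dcoef_eq0 W e X WS sX 2 1 (- (2 * s * l)) t te isT.
by rewrite /weighted_integral => ->; rewrite !addr0.
Qed.

Lemma is_derive_energy t : `|t| < e / 2 ->
  is_derive t 1 (fun r => energy mu lambda nabla (X r))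
    (2^-1 * J (fun x => 'D_tau trace_quadratic x) t).
Proof.
move=> te; have e2e : e / 2 < e by rewrite ltr_pdivrMr // ltr_pMr // ltr1n.
apply: (@near_eq_is_derive _ _ _ (fun r => 2^-1 * J trace_quadratic r)).
  near=> r; rewrite energy_quadratic //; near: r.
  have : open [set r : R | `|r| < e].
    rewrite (_ : [set r | _] = ball (0 : R) e); first exact: ball_open.
    by apply/seteqP; split => r; rewrite -ball_normE /= sub0r normrN.
  by move=> o; apply: (open_nbhs_nbhs (conj o _)); exact: lt_trans e2e.
exact: is_derive_mull (is_derive_weighted_integral e0 WS _ smooth_trace_quadratic te).
Unshelve. all: by end_near. Qed.

Lemma energy_second_derivative :
  has_second_derivative0 (fun t : R^o => energy mu lambda nabla (X t) : R^o)
    (2^-1 * J (fun x => 'D_tau (fun y => 'D_tau trace_quadratic y) x) 0).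
Proof.
have e20 : 0 < e / 2 by rewrite divr_gt0.
split.
  by near=> t; have [] := @is_derive_energy t _ => //; near: t; apply: nbhs0_lt.
apply: (@near_eq_is_derive _ _ _ (fun r => 2^-1 * J (fun x => 'D_tau trace_quadratic x) r)).
  near=> t; rewrite derive1E; apply/esym.
  by have [] := @is_derive_energy t _ => //; near: t; apply: nbhs0_lt.
apply: is_derive_mull; apply: (is_derive_weighted_integral e0 WS) => //.
- exact: (smooth_on_derive tau smooth_trace_quadratic).
- by rewrite normr0.
Unshelve. all: by end_near. Qed.

Lemma energy_first_derivative : is_derive (0 : R^o) 1
  (fun t : R^o => energy mu lambda nabla (X t) : R^o) 0.
Proof.
have e20 : `|0 : R| < e / 2 by rewrite normr0 divr_gt0.
apply: is_derive_eq (is_derive_energy e20) _.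
have -> : J (fun x => 'D_tau trace_quadratic x) 0 = \int[mu3]_(u in dom) 0.
  apply: eq_Rintegral => u _; have [_ -> _] := second_order_trace (S3_hopf u); exact: mul0r.
have mb : measurable (hopf_chart_dom (R := R) :
    set (measurableTypeR R * measurableTypeR R * measurableTypeR R)%type).
  exact: measurable_box.
by rewrite (Rintegral_cst mu3 mb 0) mul0r mulr0.
Qed.

Lemma weighted_integral_hessian :
  J (fun x => 'D_tau (fun y => 'D_tau trace_quadratic y) x) 0 =
  \int[mu3]_(u in dom)
    (trace_hessian ((0 : R^o), hopf_chart u) * weight (Num.sqrt lambda) u).
Proof.
by apply: eq_Rintegral => u _; have [_ _ ->] := second_order_trace (S3_hopf u).
Qed.

End Hopf.

End Trace.
End Energy.

(** * Time derivatives of the components in terms of the velocity *)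

Section Velocity.
Context {R : realType}.
Local Notation E := 'rV[R]_4.
Local Notation V := (R^o * E)%type.
Variables (W : set V) (e : R) (X : R -> E -> E) (A : E -> E).
Hypotheses (e0 : 0 < e).
Hypothesis WS : forall (t : R) p, `|t| < e -> S3 p -> W ((t : R^o), p).
Hypothesis sX : smooth_on W (fun x : V => X x.1 x.2).
Hypothesis XA : forall p, S3 p -> 'D_1 (fun t : R^o => X t p) 0 = A p.
Implicit Types (p q : E) (t : R).

Let tau : V := (1, 0).

Let W0 p : S3 p -> W ((0 : R^o), p).
Proof. by move=> p1; apply: WS => //; rewrite normr0. Qed.

Lemma derive_vcoef j p : S3 p ->
  'D_tau (vcoef X j) ((0 : R^o), p) = dot (A p) (frame j p).
Proof.
move=> p1; have Wp := W0 p1.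
have dX := is_derive_slicel (smooth_on_is_derive tau sX Wp).
have -> : A p = 'D_tau (fun x : V => X x.1 x.2) ((0 : R^o), p).
  by rewrite -(XA p1); have [_ <-] := dX.
have [_ <-] := is_derive_slicel (smooth_on_is_derive tau (smooth_vcoef sX j) Wp).
have [_ ->] := is_derive_dot dX (is_derive_cst (frame j p) (0 : R^o) (1 : R^o)).
by rewrite [Z in _ + Z]dotC -[Z in _ + dot Z _](scale0r 0) dotZl mul0r addr0.
Qed.

(** Time and space derivatives commute, and what remains is a frame derivative of the time
    derivative of the component. The latter is known on S^3 only, where any smooth [g] with the same
    values may replace it. *)
Lemma derive_dcoef i j (U : set E) (g : E -> R^o) p :
  smooth_on U g -> @S3 R `<=` U ->
  (forall q, S3 q -> dot (A q) (frame j q) = g q) -> S3 p ->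
  'D_tau (dcoef X i j) ((0 : R^o), p) = 'D_(frame i p) g p.
Proof.
move=> sg SU Ag p1; have Wp := W0 p1; have sc := smooth_vcoef sX j.
pose v : V := (0, frame i p).
have near_e : \forall t \near (0 : R), `|t| < e by exact: nbhs0_lt.
have [_ <-] := is_derive_slicel (smooth_on_is_derive tau (smooth_dcoef sX i j) Wp).
have [_ h] := is_derive_slicel (smooth_on_is_derive tau (smooth_on_derive v sc) Wp).
transitivity ('D_1 (fun t : R => 'D_v (vcoef X j) ((t : R^o), p)) 0).
  apply: near_eq_derive; near=> t.
  apply: (dcoefE sX i j); apply: (WS _ p1); near: t; exact: near_e.
rewrite h (smooth_on_deriveC _ _ sc Wp) -(derive_slicer (frame i p) (smooth_on_derive tau sc) Wp).
have s0 := smooth_on_slicer (0 : R^o) (smooth_on_derive tau sc).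
pose U' := [set q | W ((0 : R^o), q)] `&` U.
have oU' : open U' by apply: openI; [exact: smooth_on_open s0|exact: smooth_on_open sg].
apply: (@derive_frame_tangent _ U' _ _ i p (smooth_onW oU' (@subIsetl _ _ _) s0)
  (smooth_onW oU' (@subIsetr _ _ _) sg) _ _ p1).
- by move=> q q1; split; [exact: W0|exact: SU].
- by move=> q q1; rewrite (derive_vcoef j q1); exact: Ag.
Unshelve. all: by end_near. Qed.

End Velocity.

(** * The test field *)

Section TestField.
Context {R : realType}.
Local Notation E := 'rV[R]_4.
Local Notation V := (R^o * E)%type.
Implicit Types (p q w : E) (t : R).

Definition test_coef (j : 'I_3) (q : E) : R^o := [:: 0; - q 0 2; q 0 3]`_j.

(* The components satisfy V (a1 + i a2) = - i (a1 + i a2): with this sign the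
   derivative along V partly cancels the zeroth order term (mu - 2) a in the
   Hessian, which is what produces (mu - 3)^2. *)
Definition test_field (q : E) : E := - q 0 2 *: jmul q + q 0 3 *: kmul q.

Lemma test_coefE q : ((test_coef 0 q = 0) * (test_coef 1 q = - q 0 2) *
  (test_coef 2 q = q 0 3))%type.
Proof. by []. Qed.

Lemma dot_test_field j q : S3 q -> dot (test_field q) (frame j q) = test_coef j q.
Proof.
rewrite /S3 /= => q1; rewrite /test_field -frame1 -frame2 dotDl !dotZl !dot_frame q1.
by elim/ord3P: j; rewrite test_coefE /=; ring.
Qed.

Lemma smooth_test_coef (U : set E) j : open U -> smooth_on U (test_coef j).
Proof.
move=> oU; have sc k := smooth_on_coord 0 k (smooth_on_idE oU).
by elim/ord3P: j; [exact: (smooth_on_cst (0 : R^o) oU)|exact: (smooth_onN (sc 2))|exact: sc 3].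
Qed.

Lemma derive_test_coef j p w : 'D_w (test_coef j) p = test_coef j w.
Proof.
suff [_ ->] : is_derive p w (test_coef j) (test_coef j w) by [].
have -> : p = 0 *: w + p by rewrite scale0r add0r.
apply: (is_derive_line (test_coef j) p w (test_coef j w) 0).2.
rewrite (_ : (fun _ => _) = (fun t : R => t *: test_coef j w + test_coef j p)); last first.
  apply/funext => t; elim/ord3P: j; rewrite !test_coefE ?mxE /GRing.scale /=; ring.
apply: (is_derive_line id (test_coef j p) (test_coef j w) (test_coef j w) 0).1.
Qed.

Section TraceHessian.
Variables (mu lambda : R) (W : set V) (e : R) (X : R -> E -> E).
Hypotheses (e0 : 0 < e) (lambda0 : 0 < lambda).
Hypothesis WS : forall (t : R) p, `|t| < e -> S3 p -> W ((t : R^o), p).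
Hypothesis sX : smooth_on W (fun x : V => X x.1 x.2).
Hypothesis XA : forall p, S3 p -> 'D_1 (fun t : R^o => X t p) 0 = test_field p.

(** The derivatives along V and the terms with [mu - 2] combine to (3 - mu) x2 and (3 - mu) x3. The
    coefficient - mu is mu, from the squares with [dcoef] 1 0 and 2 0, minus 2 mu from the unit
    length condition; x0 and x1 come from the derivatives of x2 and x3 along j p and k p. *)
Lemma trace_hessian_test_field p : S3 p ->
  trace_hessian mu lambda X ((0 : R^o), p) =
  2 * (((3 - mu) ^+ 2 / lambda - mu) * (p 0 2 ^+ 2 + p 0 3 ^+ 2) +
       2 * (p 0 0 ^+ 2 + p 0 1 ^+ 2)).
Proof.
move=> p1; have Wp : W ((0 : R^o), p) by apply: WS => //; rewrite normr0.
pose tau : V := (1, 0).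
have dc j : is_derive ((0 : R^o), p) tau (vcoef X j) (test_coef j p).
  rewrite -(dot_test_field j p1) -(derive_vcoef e0 WS sX XA j p1).
  exact: (smooth_on_is_derive tau (smooth_vcoef sX j) Wp).
have dd i j : is_derive ((0 : R^o), p) tau (dcoef X i j) (test_coef j (frame i p)).
  rewrite -(derive_test_coef j p) -(derive_dcoef e0 WS sX XA i (smooth_test_coef j openT)
    (@subsetT _ _) (dot_test_field j) p1).
  exact: (smooth_on_is_derive tau (smooth_dcoef sX i j) Wp).
have dk (k : R) j : is_derive ((0 : R^o), p) tau (fun y => k * vcoef X j y : R^o) (k * test_coef j p).
  apply: is_derive_eq (is_deriveM (is_derive_cst (k : R^o) _ _) (dc j)) _.
  by rewrite scaler0 addr0.
have ds (k : R) : is_derive ((0 : R^o), p) tau (fun=> k : R^o) 0 := is_derive_cst (k : R^o) _ _.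
rewrite /trace_hessian.
have [_ ->] := dd 0 0; have [_ ->] := dd 1 1; have [_ ->] := dd 2 2.
have [_ ->] := dc 1; have [_ ->] := dc 2.
have [_ ->] := is_deriveB (dd 0 1) (dk (mu - 2) 2).
have [_ ->] := is_deriveD (dd 0 2) (dk (mu - 2) 1).
have [_ ->] := is_deriveB (dd 1 0) (dc 2).
have [_ ->] := is_deriveD (dd 2 0) (dc 1).
have [_ ->] := is_deriveB (is_deriveD (dd 1 2) (dk mu 0)) (ds (Num.sqrt mu)).
have [_ ->] := is_deriveD (is_deriveB (dd 2 1) (dk mu 0)) (ds (Num.sqrt mu)).
have [_ ->] := is_deriveB (dc 0) (ds (Num.sqrt mu)^-1).
rewrite !test_coefE !frameE !vec4E; field.
by rewrite gt_eqF.
Qed.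

End TraceHessian.
End TestField.

(** * Integrals of quadratic polynomials over S^3 *)

Section Integrals.
Context {R : realType}.
Local Notation E := 'rV[R]_4.
Local Notation mu3 := (@lebesgue_measure R \x @lebesgue_measure R \x @lebesgue_measure R)%E.
Local Notation dom := (@hopf_chart_dom R).
Implicit Types (p q w : E).

Let pi2 : (0 : R) < pi / 2. Proof. by rewrite divr_gt0 // pi_gt0. Qed.
Let pipi : (0 : R) < 2 * pi. Proof. by rewrite mulr_gt0 // pi_gt0. Qed.
Let box_integrable := continuous_box_integrable pi2 pipi pipi.
Let mdom : measurable (hopf_chart_dom (R := R) :
    set (measurableTypeR R * measurableTypeR R * measurableTypeR R)%type).
Proof. exact: measurable_box. Qed.

(** The constant K / pi is the mean of K cos x sin x over the interval from 0 to pi / 2. Once it is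
    subtracted, every slice in x integrates to 0, and the measure 2 pi^3 of the box gives the
    rest. *)
Lemma integral_weight K : \int[mu3]_(u in dom) weight K u = 2 * pi ^+ 2 * K.
Proof.
have pN : (pi : R) != 0 by rewrite gt_eqF // pi_gt0.
have ccst : continuous (fun _ : R * R * R => - (K / pi)) by move=> u; exact: cvg_cst.
have ccst' : continuous (fun _ : R * R * R => K / pi) by move=> u; exact: cvg_cst.
have cw := continuous_funD (@continuous_weight R K) ccst.
have -> : \int[mu3]_(u in dom) weight K u =
    \int[mu3]_(u in dom) ((weight K u - K / pi) + K / pi).
  by apply: eq_Rintegral => u _; rewrite subrK.
rewrite (RintegralD mdom (box_integrable cw) (box_integrable ccst')).
have -> : \int[mu3]_(u in dom) (weight K u - K / pi) = 0.
  apply: (integral_box_eq0_fst pi2 pipi pipi cw) => y z.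
  pose F (x : R) : R := K / 2 * (sin x * sin x) + (- (K / pi)) * x.
  have cf : continuous (fun x : R => K * (cos x * sin x) - K / pi).
    move=> x; apply: cvgB; last exact: cvg_cst.
    apply: cvgM; first exact: cvg_cst.
    by apply: cvgM; [exact: continuous_cos|exact: continuous_sin].
  apply: (@integral_derive_eq0 R _ _ F _ pi2 cf) => [x|].
    have d1 : is_derive x 1 (fun x : R => K / 2 * (sin x * sin x)) (K * (cos x * sin x)).
      apply: is_derive_eq (is_derive_mull (K / 2) (is_deriveM (is_derive_sin x) (is_derive_sin x))) _.
      by rewrite /GRing.scale /=; field.
    have d2 : is_derive x 1 (fun x : R => (- (K / pi)) * x) (- (K / pi)).
      by apply: is_derive_eq (is_derive_mull (- (K / pi)) (is_derive_id x 1)) _; rewrite mulr1.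
    exact: (is_deriveD d1 d2).
  by rewrite /F sin0 sin_pihalf; move: (pi : R) pN => k kN; field.
rewrite add0r (Rintegral_cst mu3 mdom).
rewrite [X in fine X](_ : _ = ((pi / 2 - 0) * (2 * pi - 0) * (2 * pi - 0))%:E).
  by rewrite !subr0 [fine _]/=; move: (pi : R) pN => k kN; field.
exact: measure_box.
Qed.

(** The polynomial x0^2 + x1^2 - x2^2 - x3^2 is the derivative of x0 x2 - x1 x3 along j p. *)
Lemma integral_balance K :
  \int[mu3]_(u in dom) ((hopf_chart u 0 0 ^+ 2 + hopf_chart u 0 1 ^+ 2 -
     hopf_chart u 0 2 ^+ 2 - hopf_chart u 0 3 ^+ 2) * weight K u) = 0.
Proof.
pose phi q : R^o := q 0 0 * q 0 2 - q 0 1 * q 0 3.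
have sc k := smooth_on_coord 0 k (smooth_on_idE (@openT E)).
have sphi : smooth_on setT phi.
  exact: (smooth_onB (smooth_onM (sc 0) (sc 2)) (smooth_onM (sc 1) (sc 3))).
rewrite -(integral_field_eq0 1 0 K sphi (@subsetT _ _)).
apply: eq_Rintegral => u _.
have dx p w k : is_derive p w (fun q => q 0 k : R^o) (w 0 k).
  have [Dd Dv] := is_derive_id p w; apply: DeriveDef.
    exact: ((derivable_mxP (fun q : E => q) p w).1 Dd).
  by rewrite -[in RHS]Dv derive_mx // mxE.
set p := hopf_chart u; set v := _ *: _.
have [_ ->] := is_deriveB (is_deriveM (dx p v 0) (dx p v 2)) (is_deriveM (dx p v 1) (dx p v 3)).
by rewrite /v !mxE /= /weight /GRing.scale /=; ring.
Qed.

(** With a = x0^2 + x1^2, b = x2^2 + x3^2 and a + b = 1, one has 2 (k b + 2 a) = (k + 2) + (2 - k)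
    (a - b), and a - b integrates to 0. *)
Lemma integral_quadratic (k K : R) :
  \int[mu3]_(u in dom) (2 * (k * (hopf_chart u 0 2 ^+ 2 + hopf_chart u 0 3 ^+ 2) +
     2 * (hopf_chart u 0 0 ^+ 2 + hopf_chart u 0 1 ^+ 2)) * weight K u) =
  \int[mu3]_(u in dom) weight ((k + 2) * K) u.
Proof.
pose b u := hopf_chart u 0 0 ^+ 2 + hopf_chart u 0 1 ^+ 2 -
     hopf_chart u 0 2 ^+ 2 - hopf_chart u 0 3 ^+ 2 : R.
have cb : continuous (fun u => b u * weight ((2 - k) * K) u).
  have sc i := smooth_on_coord 0 i (smooth_on_idE (@openT E)).
  have sb : smooth_on setT (fun q : E => q 0 0 * q 0 0 + q 0 1 * q 0 1 -
      q 0 2 * q 0 2 - q 0 3 * q 0 3 : R^o).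
    exact: (smooth_onB (smooth_onB (smooth_onD (smooth_onM (sc 0) (sc 0))
      (smooth_onM (sc 1) (sc 1))) (smooth_onM (sc 2) (sc 2))) (smooth_onM (sc 3) (sc 3))).
  apply: continuous_funM; last exact: continuous_weight.
  exact: (continuous_comp_hopf sb (@subsetT _ _)).
transitivity (\int[mu3]_(u in dom) (weight ((k + 2) * K) u + b u * weight ((2 - k) * K) u)).
  apply: eq_Rintegral => u _; rewrite /b /weight.
  have := S3_hopf u; rewrite /S3 /= dotE.
  move: (hopf_chart u) (cos _) (sin _) => p c s p1.
  have -> : p 0 3 ^+ 2 = 1 - (p 0 0 ^+ 2 + p 0 1 ^+ 2 + p 0 2 ^+ 2) by rewrite -p1; ring.
  by ring.
rewrite (RintegralD mdom (box_integrable (@continuous_weight R _)) (box_integrable cb)).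
by rewrite [X in _ + X]integral_balance addr0.
Qed.

End Integrals.

(** * A variation with the test field as velocity *)

Section TestVariation.
Context {R : realType}.
Local Notation E := 'rV[R]_4.
Local Notation V := (R^o * E)%type.
Variable mu : R.
Hypothesis mu0 : 0 < mu.
Implicit Types (p q : E) (t : R).

Let s := Num.sqrt mu.
Let s0 : 0 < s. Proof. by rewrite sqrtr_gt0. Qed.
Let smu : mu = s ^+ 2. Proof. by rewrite sqr_sqrtr // ltW. Qed.

(** Spherical coordinates on the ellipsoid of g_mu-unit vectors, in frame components. Compared with
    normalizing V^mu + t A, they avoid a square root and a quotient, so the variation is smooth on
    all of R x R^4. *)
Definition test_rotation (a b : R) (i : 'I_3) : R^o :=
  [:: s^-1 * (cos a * cos b); sin a * cos b; sin b]`_i.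

Definition test_variation t q : E :=
  \sum_i test_rotation (t * test_coef 1 q) (t * test_coef 2 q) i *: frame i q.

Lemma test_variation_coord t q k : test_variation t q 0 k =
  \sum_i test_rotation (t * test_coef 1 q) (t * test_coef 2 q) i * frame i q 0 k.
Proof. by rewrite summxE; apply: eq_bigr => i _; rewrite mxE. Qed.

Lemma dot_test_variation t q j : S3 q -> dot (test_variation t q) (frame j q) =
  test_rotation (t * test_coef 1 q) (t * test_coef 2 q) j.
Proof.
rewrite /S3 /= => q1; rewrite /test_variation !big_ord_recl big_ord0 addr0 !dotDl !dotZl !dot_frame q1.
by elim/ord3P: j => /=; ring.
Qed.

Lemma smooth_test_variation : smooth_on setT (fun x : V => test_variation x.1 x.2).
Proof.
have sp := smooth_on_point (@openT V); have st := smooth_on_time (@openT V).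
apply: (smooth_on_mx openT) => i; rewrite {i}(ord1 i) => k.
rewrite (_ : (fun _ => _) = fun x : V => \sum_i
    test_rotation (x.1 * test_coef 1 x.2) (x.1 * test_coef 2 x.2) i * frame i x.2 0 k : R^o);
  last by apply/funext => x; rewrite test_variation_coord.
apply: (smooth_on_sum openT) => j.
apply: smooth_onM; last exact: (smooth_on_coord 0 k (smooth_on_frame_comp j sp)).
have s1 : smooth_on setT (fun x : V => x.1 * test_coef 1 x.2 : R^o).
  exact: (smooth_onM st (smooth_onN (smooth_on_coord 0 2 sp))).
have s2 : smooth_on setT (fun x : V => x.1 * test_coef 2 x.2 : R^o).
  exact: (smooth_onM st (smooth_on_coord 0 3 sp)).
elim/ord3P: j.
- exact: (smooth_onM (smooth_on_cst (s^-1 : R^o) openT)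
    (smooth_onM (smooth_on_cos s1) (smooth_on_cos s2))).
- exact: (smooth_onM (smooth_on_sin s1) (smooth_on_cos s2)).
- exact: (smooth_on_sin s2).
Qed.

Lemma test_variation_tangent t : tangent (test_variation t).
Proof.
move=> p _; rewrite /test_variation !big_ord_recl big_ord0 addr0 !dotDl !dotZl !dot_frame_self.
by rewrite !mulr0 !addr0.
Qed.

Lemma unit_field_test_variation t : unit_field mu (test_variation t).
Proof.
split; first split.
- exists [set q | [set: V] ((t : R^o), q)]; first by [].
  exact: (smooth_on_slicer (t : R^o) smooth_test_variation).
- exact: test_variation_tangent.
- move=> p p1; rewrite (berger_tangent _ _ p1); last exact: test_variation_tangent.
  rewrite sum3 !(dot_test_variation _ _ p1).
  move: (t * test_coef 1 p) (t * test_coef 2 p) => a b.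
  rewrite /frame_weight /test_rotation /= smu.
  have ha := cos2Dsin2 a; have hb := cos2Dsin2 b.
  have sN : s != 0 by rewrite gt_eqF.
  transitivity ((cos a ^+ 2 + sin a ^+ 2) * cos b ^+ 2 + sin b ^+ 2).
    by field.
  by rewrite ha mul1r.
Qed.

Lemma test_variation0 q : test_variation 0 q = hopf_field mu q.
Proof.
rewrite /test_variation !big_ord_recl big_ord0 addr0 /test_rotation /= !mul0r cos0 sin0.
by rewrite !mulr1 !scale0r !addr0.
Qed.

Lemma derive_test_variation q : 'D_1 (fun t : R^o => test_variation t q) 0 = test_field q.
Proof.
set a := test_coef 1 q; set b := test_coef 2 q.
have dl (k : R) : is_derive (0 : R) 1 (fun t : R => t * k) k.
  by apply: is_derive_eq (is_derive_mulr k (is_derive_id (0 : R) 1)) _; rewrite mul1r.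
have dsin (k : R) : is_derive (0 : R) 1 (fun t : R => sin (t * k)) k.
  apply: is_derive_eq (@is_derive_chain _ _ sin (fun t : R => t * k) _ _ (0 : R) 1
    (is_derive_sin (0 * k)) (dl k)) _.
  by rewrite mul0r cos0 mul1r.
have dcos (k : R) : is_derive (0 : R) 1 (fun t : R => cos (t * k)) 0.
  apply: is_derive_eq (@is_derive_chain _ _ cos (fun t : R => t * k) _ _ (0 : R) 1
    (is_derive_cos (0 * k)) (dl k)) _.
  by rewrite mul0r sin0 oppr0 mul0r.
have dr i : is_derive (0 : R) 1 (fun t : R => test_rotation (t * a) (t * b) i) (test_coef i q).
  elim/ord3P: i.
  - apply: is_derive_eq (is_derive_mull s^-1 (is_deriveM (dcos a) (dcos b))) _.
    by rewrite !scaler0 addr0 mulr0.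
  - apply: is_derive_eq (is_deriveM (dsin a) (dcos b)) _.
    by rewrite !mul0r cos0 scaler0 add0r scale1r.
  - exact: dsin.
have dk k : is_derive (0 : R) 1 (fun t : R => test_variation t q 0 k) (test_field q 0 k).
  rewrite (_ : (fun _ => _) = (fun t : R => \sum_i test_rotation (t * a) (t * b) i * frame i q 0 k));
    last by apply/funext => t; rewrite test_variation_coord.
  have d i := is_derive_mulr (frame i q 0 k) (dr i).
  rewrite (_ : (fun _ => _) = \sum_i (fun t : R => test_rotation (t * a) (t * b) i * frame i q 0 k));
    last by apply/funext => t; rewrite fct_sumE.
  apply: is_derive_eq (is_derive_sum d) _.
  by rewrite sum3 !mxE /= mul0r add0r.
rewrite derive_mx; first by apply/rowP => k; rewrite mxE; have [_ ->] := dk k.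
by apply/derivable_mxP => i k; rewrite {i}(ord1 i); have [] := dk k.
Qed.

Lemma test_variationP : unit_variation mu (hopf_field mu) test_variation test_field.
Proof.
exists 1; split.
- exact: ltr01.
- by exists setT; [|exact: smooth_test_variation].
- by move=> t _; exact: unit_field_test_variation.
- by move=> p _; exact: test_variation0.
- by move=> p _; exact: derive_test_variation.
Qed.

End TestVariation.

(** The variation [X] is arbitrary, and the value found depends on its velocity only;
    [test_variation] is there to show that some variation has this velocity. The factor pi^2 is half
    of 2 pi^2, the round volume of S^3. *)
Lemma hessian_test_field (R : realType) (mu lambda : R)
  (nabla : ('rV[R]_4 -> 'rV[R]_4) -> ('rV[R]_4 -> 'rV[R]_4) -> 'rV[R]_4 -> 'rV[R]_4) :
  0 < mu -> 0 < lambda -> levi_civita mu nabla ->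
  hessian mu lambda nabla (hopf_field mu) (@test_field R)
    (pi ^+ 2 * Num.sqrt lambda * ((3 - mu) ^+ 2 / lambda - mu + 2)).
Proof.
move=> mu0 lambda0 hnabla; split; first by exists (@test_variation R mu); exact: test_variationP.
move=> X [e [e0 [W WS sX] uX X0 XA]].
have := energy_second_derivative mu0 lambda0 hnabla WS sX uX e0 X0.
rewrite (weighted_integral_hessian lambda mu0 WS sX e0 X0).
congr (has_second_derivative0 _ _).
set k := (3 - mu) ^+ 2 / lambda - mu; set l := Num.sqrt lambda.
transitivity (2^-1 * \int[(@lebesgue_measure R \x @lebesgue_measure R \x @lebesgue_measure R)%E]_(u
    in hopf_chart_dom (R := R)) weight ((k + 2) * l) u); last first.
  by rewrite integral_weight; field.
congr (_ * _); rewrite -integral_quadratic; apply: eq_Rintegral => u _.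
by rewrite (trace_hessian_test_field mu e0 lambda0 WS sX XA (S3_hopf u)).
Qed.

Theorem proposition4p3 (R : realType) (mu lambda : R)
  (nabla : ('rV[R]_4 -> 'rV[R]_4) -> ('rV[R]_4 -> 'rV[R]_4) ->
           'rV[R]_4 -> 'rV[R]_4)
  (hmu0 : 0 < mu) (hlambda0 : 0 < lambda)
  (hnabla : levi_civita mu nabla)
  (hmu : 2 < mu) (hlambda : (mu - 3) ^+ 2 / (mu - 2) < lambda) :
  unstable_critical_point mu lambda nabla (hopf_field mu).
Proof.
split.
  move=> X A [e [e0 [W WS sX] uX X0 _]].
  exact: (energy_first_derivative hmu0 hlambda0 hnabla WS sX uX e0 X0).
exists (@test_field R); eexists; split; last 2 first.
- exact: hessian_test_field.
- rewrite pmulr_rlt0; last by rewrite mulr_gt0 ?sqrtr_gt0 // exprn_gt0 // pi_gt0.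
  (* Since lambda and mu - 2 are positive, this inequality and the hypothesis both amount to (mu -
     3)^2 < lambda (mu - 2). *)
  suff : (3 - mu) ^+ 2 / lambda < mu - 2 by move: (_ / _) => a; lra.
  by rewrite ltr_pdivrMr // mulrC -sqrrN opprB -ltr_pdivrMr // subr_gt0.
- split; first split.
  + exists setT; first by [].
    apply: (smooth_on_mx openT) => i; rewrite {i}(ord1 i) => k.
    have sI := smooth_on_idE (@openT 'rV[R]_4).
    have sc j := smooth_on_coord 0 j sI.
    have sf i := smooth_on_coord 0 k (smooth_on_frame_comp i sI).
    rewrite (_ : (fun _ => _) = fun q : 'rV[R]_4 =>
        - q 0 2 * frame 1 q 0 k + q 0 3 * frame 2 q 0 k : R^o).
      exact: (smooth_onD (smooth_onM (smooth_onN (sc 2)) (sf 1)) (smooth_onM (sc 3) (sf 2))).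
    by apply/funext => q; rewrite !mxE.
  + move=> p _; rewrite /test_field -frame1 -frame2 dotDl !dotZl !dot_frame_self.
    by rewrite !mulr0 addr0.
  + move=> p p1; rewrite /hopf_field bergerC bergerZl -frame0 (berger_tangent _ _ p1) ?dot_frame_self //.
    rewrite sum3 !(dot_test_field _ p1) !dot_frame test_coefE /=; ring.
Qed.
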